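(* Let $\Bbbk$ be an algebraically closed field of characteristic $0$ and let $X$ be an irreducible smooth algebraic variety over $\Bbbk$ with structure sheaf $\mathcal{O}$ and tangent sheaf $\Theta$. Let $\mathcal{F}$ be a finite type infeq sheaf on $X$. Then the associated Lie map $L:\Theta\to\mathrm{At}(\mathcal{F})$ is a differential operator of order bounded above by $\operatorname{rank}(\mathcal{F})^2$.
   Context: $\Theta$ is the sheaf with $\Gamma(U,\Theta)=\mathrm{Der}_{\Bbbk}(B)$ for each affine open $U=\mathrm{Spec}(B)\subset X$. A (quasi-coherent) sheaf of $\mathcal{O}$-modules $\mathcal{M}$ is called infinitesimally equivariant (infeq) if for each affine open $U=\mathrm{Spec}(B)$ the space $\Gamma(U,\mathcal{M})$ is a module over the Lie algebra $\Gamma(U,\Theta)$, compatibly with restriction, such that $\eta\cdot(f\cdot m)=\eta(f)\cdot m+f\cdot(\eta\cdot m)$ for all $\eta\in\Gamma(U,\Theta)$, $f\in B$, $m\in\Gamma(U,\mathcal{M})$. The Atiyah algebra $\mathrm{At}(\mathcal{M})$ is the preimage of $\Theta$ (embedded as $\eta\mapsto\eta\otimes\mathrm{id}$) under the symbol map $\sigma:\mathrm{Diff}^{\le1}(\mathcal{M},\mathcal{M})\to\Theta\otimes\mathrm{End}_{\mathcal{O}}(\mathcal{M})$, where $\mathrm{Diff}^{\le 1}(\mathcal{M},\mathcal{M})$ is the sheaf of differential operators from $\mathcal{M}$ to itself of order at most one; i.e. local sections are $\Bbbk$-linear operators $D$ with $D(fm)=fD(m)+\eta(f)m$ for some vector field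 $\eta$. It is a left $\mathcal{O}$-module via $(fD)(m)=f\,D(m)$. Equivalently, an infeq sheaf is a sheaf $\mathcal{M}$ equipped with a $\Bbbk$-linear Lie algebra splitting $L:\Theta\to\mathrm{At}(\mathcal{M})$ of the symbol $\sigma:\mathrm{At}(\mathcal{M})\to\Theta$; this splitting $L$, given by $L(\eta)(m)=\eta\cdot m$, is called the Lie map. $\operatorname{rank}(\mathcal{F})$ is the generic rank, i.e. the dimension of the stalk of $\mathcal{F}$ at the generic point over the function field of $X$. A $\Bbbk$-linear sheaf map $\varphi$ between $\mathcal{O}$-modules is a differential operator of order $\le n$ if, locally, $[\dots[[\varphi,f_0],f_1],\dots,f_n]=0$ for all local functions $f_0,\dots,f_n$, where $[\varphi,f](x)=\varphi(fx)-f\varphi(x)$. *)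

(* Defs.v *)
From HB Require Import structures.
From mathcomp Require Import all_boot all_order all_algebra.
From mathcomp Require Import ring.
From mathcomp Require Import all_classical topology.

Set Implicit Arguments.
Unset Strict Implicit.
Unset Printing Implicit Defensive.

Import GRing.Theory.
Local Open Scope classical_set_scope.
Local Open Scope ring_scope.

(* Commutative [k]-algebras are given by a ring morphism [iota : k -> B] with
   [B : comPzRingType], since MathComp's [comAlgType] excludes the zero ring,
   which is the ring of functions on the empty open set. *)

Section Commutators.
Context {R : comPzRingType} {M N : lmodType R}.

Definition commutator (phi : M -> N) (f : R) : M -> N :=
  fun x => phi (f *: x) - f *: phi x.

Definition klinear {k : fieldType} (iota : {rmorphism k -> R}) (phi : M -> N) :=
  (forall x y, phi (x + y) = phi x + phi y) /\
  (forall c x, phi (iota c *: x) = iota c *: phi x).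

Definition diffop_le {k : fieldType} (iota : {rmorphism k -> R}) (n : nat)
    (phi : M -> N) :=
  klinear iota phi /\
  forall (fs : n.+1.-tuple R) (x : M), foldl commutator phi fs x = 0.

End Commutators.

Section Derivations.
Context {k : fieldType} {B : comPzRingType} (iota : {rmorphism k -> B}).

(* Derivations are valued in [B^o], i.e. in [B] seen as a [B]-module, so that
   functions [B -> B^o] carry the pointwise [B]-module structure. *)
Definition is_derivation : {pred B -> B^o} := fun d =>
  `[< [/\ forall f g, d (f + g) = d f + d g,
          forall c f, d (iota c * f) = iota c * d f
        & forall f g, d (f * g) = d f * g + f * d g ] >].

Lemma is_derivationP (d : B -> B^o) :
  reflect [/\ forall f g, d (f + g) = d f + d g,
              forall c f, d (iota c * f) = iota c * d f
            & forall f g, d (f * g) = d f * g + f * d g ]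
          (d \in is_derivation).
Proof. exact: asboolP. Qed.

Fact is_derivation_submod : submod_closed is_derivation.
Proof.
split=> [|a d e /is_derivationP[dD dk dM] /is_derivationP[eD ek eM]].
  by apply/is_derivationP; split=> *; rewrite /= ?mul0r ?mulr0 ?addr0.
have E x : (a *: d + e) x = a * d x + e x by [].
apply/is_derivationP; split=> [f g|c f|f g]; rewrite !E.
- by rewrite dD eD mulrDr addrACA.
- by rewrite dk ek mulrDr mulrCA.
- by rewrite dM eM mulrDl !mulrDr !mulrA (mulrC f a) addrACA.
Qed.
HB.instance Definition _ :=
  GRing.isSubmodClosed.Build B (B -> B^o) is_derivation is_derivation_submod.

Record Der := MkDer {
  der_fun :> B -> B^o; der_funP : der_fun \in is_derivation }.
HB.instance Definition _ := [isSub for der_fun].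
HB.instance Definition _ := [Choice of Der by <:].
HB.instance Definition _ := [SubChoice_isSubLmodule of Der by <:].

Fact bracket_subproof (eta mu : Der) :
  (fun f => eta (mu f) - mu (eta f) : B^o) \in is_derivation.
Proof.
have /is_derivationP[eD ek eM] := der_funP eta.
have /is_derivationP[mD mk mM] := der_funP mu.
apply/is_derivationP; split=> [f g|c f|f g].
- by rewrite mD eD eD mD opprD addrACA.
- by rewrite mk ek ek mk -mulrBr.
- by rewrite mM eM eD mD !eM !mM; ring.
Qed.
Definition bracket (eta mu : Der) : Der := MkDer (bracket_subproof eta mu).

End Derivations.

Section AtiyahAlgebra.
Context {k : fieldType} {B : comPzRingType} (iota : {rmorphism k -> B}).
Context (M : lmodType B).

(* With [M] the sections over an affine open [U] of a quasi-coherent sheaf, a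
   differential operator on [M] extends uniquely to smaller opens, so these are
   the sections over [U] of the Atiyah algebra of that sheaf. *)
Definition is_atiyah : {pred M -> M} := fun D =>
  `[< klinear iota D /\
      exists eta : Der iota, forall f m, D (f *: m) = f *: D m + eta f *: m >].

Lemma is_atiyahP (D : M -> M) :
  reflect (klinear iota D /\
    exists eta : Der iota, forall f m, D (f *: m) = f *: D m + eta f *: m)
  (D \in is_atiyah).
Proof. exact: asboolP. Qed.

Fact is_atiyah_submod : submod_closed is_atiyah.
Proof.
split=> [|a D E /is_atiyahP[[DD Dk] [d dP]] /is_atiyahP[[ED Ek] [e eP]]].
  apply/is_atiyahP; split; first by split=> *; rewrite /= ?scaler0 ?addr0.
  by exists 0 => f m; rewrite /= scaler0 scale0r addr0.
have S x : (a *: D + E) x = a *: D x + E x by [].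
apply/is_atiyahP; split; first split=> [x y|c x]; rewrite ?S.
- by rewrite DD ED scalerDr addrACA.
- by rewrite Dk Ek scalerDr !scalerA mulrC.
exists (a *: d + e) => f m; rewrite !S dP eP.
have -> : (a *: d + e) f = a * d f + e f by [].
by rewrite !scalerDr scalerDl !scalerA (mulrC a f) addrACA.
Qed.
HB.instance Definition _ :=
  GRing.isSubmodClosed.Build B (M -> M) is_atiyah is_atiyah_submod.

Record At := MkAt { at_fun :> M -> M; at_funP : at_fun \in is_atiyah }.
HB.instance Definition _ := [isSub for at_fun].
HB.instance Definition _ := [Choice of At by <:].
HB.instance Definition _ := [SubChoice_isSubLmodule of At by <:].

End AtiyahAlgebra.

Section AlgebraProperties.
Context {k : fieldType} {B : comPzRingType} (iota : {rmorphism k -> B}).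

Definition prime_ideal (P : set B) :=
  [/\ P 0, ~ P 1, forall f g, P f -> P g -> P (f + g),
      forall f g, P g -> P (f * g)
    & forall f g, P (f * g) -> P f \/ P g].

(* The only [k]-subalgebra containing some finite list [s] is [B]. *)
Definition fg_algebra := exists s : seq B, forall S : set B,
  (forall c, S (iota c)) -> (forall f, f \in s -> S f) ->
  (forall f g, S f -> S g -> S (f + g)) ->
  (forall f g, S f -> S g -> S (f * g)) -> forall f, S f.

(* Infinitesimal lifting along surjections [A -> C] of [k]-algebras whose
   kernel has square zero; the [k]-structure of [C] is [p \o iotaA]. *)
Definition formally_smooth :=
  forall (A C : comPzRingType) (iotaA : {rmorphism k -> A})
         (p : {rmorphism A -> C}),
    (forall c, exists a, p a = c) ->
    (forall a b, p a = 0 -> p b = 0 -> a * b = 0) ->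
  forall g : {rmorphism B -> C}, (forall c, g (iota c) = p (iotaA c)) ->
  exists h : {rmorphism B -> A},
    (forall c, h (iota c) = iotaA c) /\ (forall b, p (h b) = g b).

(* Over a field, finitely generated algebras are finitely presented, so this
   is EGA's "formally smooth and of finite presentation". *)
Definition smooth_algebra := fg_algebra /\ formally_smooth.

End AlgebraProperties.

Record openSet (X : topologicalType) :=
  MkOpenSet { pts :> set X; openP : open pts }.

Definition openI {X : topologicalType} (U V : openSet X) : openSet X :=
  MkOpenSet (openI (openP U) (openP V)).

Fact openI_subl {X : topologicalType} (U V : openSet X) : openI U V `<=` U.
Proof. exact: subIsetl. Qed.
Fact openI_subr {X : topologicalType} (U V : openSet X) : openI U V `<=` V.
Proof. exact: subIsetr. Qed.
Arguments openI_subl {X} U V.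
Arguments openI_subr {X} U V.

Definition is_sheaf {X : topologicalType} (E : openSet X -> Type)
    (res : forall U V : openSet X, V `<=` U -> E U -> E V) :=
  forall (I : Type) (U : openSet X) (V : I -> openSet X)
         (VU : forall i, V i `<=` U),
    U `<=` \bigcup_i V i ->
  forall s : forall i, E (V i),
    (forall i j (W : openSet X) (Wi : W `<=` V i) (Wj : W `<=` V j),
       res _ _ Wi (s i) = res _ _ Wj (s j)) ->
  exists! t : E U, forall i, res _ _ (VU i) t = s i.

(* A space with a sheaf of commutative [k]-algebras. *)
Record ringedSpace (k : fieldType) := RingedSpace {
  carrier :> topologicalType;
  fn : openSet carrier -> comPzRingType;
  fcst : forall U, {rmorphism k -> fn U};
  fres : forall U V : openSet carrier, V `<=` U -> {rmorphism fn U -> fn V};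
  fres_cst : forall (U V : openSet carrier) (VU : V `<=` U) c,
    fres VU (fcst U c) = fcst V c;
  fres_id : forall (U : openSet carrier) (UU : U `<=` U) f, fres UU f = f;
  fres_comp : forall (U V W : openSet carrier) (VU : V `<=` U) (WV : W `<=` V)
      (WU : W `<=` U) f,
    fres WV (fres VU f) = fres WU f;
  fn_sheaf : is_sheaf (fun (U V : openSet carrier) VU => fres VU : fn U -> fn V)
}.

Section Schemes.
Context {k : fieldType} (X : ringedSpace k).

(* The germ of [f] at [x] is a unit of the stalk, i.e. [f x <> 0]. *)
Definition germ_unit (U : openSet X) (f : fn U) (x : X) :=
  exists (V : openSet X) (VU : V `<=` U),
    pts V x /\ exists g, fres VU f * g = 1.

(* The non-units of each stalk form a proper additive subgroup. *)
Definition locally_ringed := forall (U : openSet X) (x : X), pts U x ->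
  ~ germ_unit (0 : fn U) x /\
  forall f g : fn U, germ_unit (f + g) x -> germ_unit f x \/ germ_unit g x.

Fact basic_open_subproof (U : openSet X) (f : fn U) : open (germ_unit f).
Proof.
rewrite openE => x [V [VU [Vx fV]]].
apply: (filterS _ (open_nbhs_nbhs (conj (openP V) Vx))) => y Vy.
by exists V, VU.
Qed.
Definition basic_open (U : openSet X) (f : fn U) : openSet X :=
  MkOpenSet (basic_open_subproof f).

Fact basic_open_sub (U : openSet X) (f : fn U) : basic_open f `<=` U.
Proof. by move=> x [V [VU [Vx _]]]; exact: VU. Qed.
Arguments basic_open_sub {U} f.

(* The canonical morphism [U -> Spec (fn U)], which maps [x] to the prime
   [{f | f x = 0}], is an isomorphism: it is bijective, the basic opens form a
   basis of the topology of [U], and the sections over a basic open are the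
   localization of [fn U] there (the restriction of [f] to [basic_open f] is
   invertible in any case). *)
Definition affine (U : openSet X) :=
  [/\ forall P : set (fn U), prime_ideal P ->
        exists! x : X, pts U x /\ forall f, P f <-> ~ germ_unit f x,
      forall V : openSet X, V `<=` U -> forall x, pts V x ->
        exists f : fn U, germ_unit f x /\ basic_open f `<=` V,
      forall f g : fn U, fres (basic_open_sub f) g = 0 ->
        exists n, f ^+ n * g = 0
    & forall (f : fn U) (h : fn (basic_open f)), exists n (g : fn U),
        fres (basic_open_sub f) g = fres (basic_open_sub f) f ^+ n * h].

Record affineOpen := AffineOpen {
  aff_open :> openSet X; affP : affine aff_open }.

Definition scheme :=
  locally_ringed /\ forall x : X, exists U : affineOpen, pts U x.

Definition reduced := forall (U : openSet X) (f : fn U) n, f ^+ n = 0 -> f = 0.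

Definition irreducible_space := [set: X] !=set0 /\
  forall A C : set X, closed A -> closed C -> A `|` C = setT ->
    A = setT \/ C = setT.

(* For affine opens [U] and [V], the intersection is affine and
   [fn U \otimes fn V -> fn (U `&` V)] is surjective; this is equivalent to
   the diagonal being a closed immersion. *)
Definition separated := forall U V : affineOpen,
  affine (openI U V) /\
  forall h : fn (openI U V), exists n (f : 'I_n -> fn U) (g : 'I_n -> fn V),
    h = \sum_i fres (openI_subl U V) (f i) * fres (openI_subr U V) (g i).

Definition of_finite_type :=
  compact [set: X] /\ forall U : affineOpen, fg_algebra (fcst U).

Definition variety := [/\ scheme, reduced, separated & of_finite_type].

Definition smooth := forall U : affineOpen, smooth_algebra (fcst U).

Definition generic_point (xi : X) := closure [set xi] = [set: X].

End Schemes.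
Arguments basic_open_sub {k X U} f.

Record moduleSheaf {k : fieldType} (X : ringedSpace k) := ModuleSheaf {
  sec :> forall U : openSet X, lmodType (fn U);
  mres : forall U V : openSet X, V `<=` U -> {additive sec U -> sec V};
  mresZ : forall (U V : openSet X) (VU : V `<=` U) (f : fn U) m,
    mres VU (f *: m) = fres VU f *: mres VU m;
  mres_id : forall (U : openSet X) (UU : U `<=` U) m, mres UU m = m;
  mres_comp : forall (U V W : openSet X) (VU : V `<=` U) (WV : W `<=` V)
      (WU : W `<=` U) m,
    mres WV (mres VU m) = mres WU m;
  sec_sheaf : is_sheaf (fun (U V : openSet X) VU => mres VU : sec U -> sec V)
}.

Section Sheaves.
Context {k : fieldType} {X : ringedSpace k} (F : moduleSheaf X).

(* [F (basic_open f)] is the localization of [F U] at [f]. *)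
Definition quasi_coherent := forall (U : affineOpen X) (f : fn U),
  (forall m : F U, mres F (basic_open_sub f) m = 0 ->
     exists n, f ^+ n *: m = 0) /\
  (forall s : F (basic_open f), exists n (m : F U),
     mres F (basic_open_sub f) m = fres (basic_open_sub f) f ^+ n *: s).

Definition finite_type := forall U : affineOpen X,
  exists n (s : 'I_n -> F U), forall m, exists f : 'I_n -> fn U,
    m = \sum_i f i *: s i.

(* The stalk of [F] at [x] is free of rank [r] over the stalk of the structure
   sheaf, with basis the germs at [x] of the sections [s i]. At the generic
   point of an integral scheme this is the dimension of the stalk over the
   function field. *)
Definition stalk_rank (x : X) (r : nat) :=
  exists (U : openSet X) (s : 'I_r -> F U), pts U x /\
  (forall (V : openSet X) (VU : V `<=` U) (f : 'I_r -> fn V), pts V x ->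
     \sum_i f i *: mres F VU (s i) = 0 ->
     forall i, exists (W : openSet X) (WV : W `<=` V),
       pts W x /\ fres WV (f i) = 0) /\
  (forall (V : openSet X) (m : F V), pts V x ->
     exists (W : openSet X) (WU : W `<=` U) (WV : W `<=` V) (f : 'I_r -> fn W),
       pts W x /\ mres F WV m = \sum_i f i *: mres F WU (s i)).

Local Notation Theta U := (Der (fcst (aff_open U))).

Definition der_restricts (U V : affineOpen X) (VU : V `<=` U)
    (eta : Theta U) (mu : Theta V) :=
  forall f : fn U, mu (fres VU f) = fres VU (eta f).

Record infeq := Infeq {
  act : forall U : affineOpen X, Theta U -> F U -> F U;
  actDl : forall (U : affineOpen X) (eta mu : Theta U) m,
    act (eta + mu) m = act eta m + act mu m;
  actZl : forall (U : affineOpen X) c (eta : Theta U) m,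
    act (fcst U c *: eta) m = fcst U c *: act eta m;
  act_klinear : forall (U : affineOpen X) (eta : Theta U),
    klinear (fcst U) (act eta);
  act_bracket : forall (U : affineOpen X) (eta mu : Theta U) m,
    act (bracket eta mu) m = act eta (act mu m) - act mu (act eta m);
  act_leibniz : forall (U : affineOpen X) (eta : Theta U) (f : fn U) m,
    act eta (f *: m) = (eta f : fn U) *: m + f *: act eta m;
  act_res : forall (U V : affineOpen X) (VU : V `<=` U) (eta : Theta U)
      (mu : Theta V), der_restricts VU eta mu ->
    forall m, mres F VU (act eta m) = act mu (mres F VU m)
}.

Local Notation atiyah U := (At (fcst (aff_open U)) (F (aff_open U))).

Fact lie_map_subproof (a : infeq) (U : affineOpen X) (eta : Theta U) :
  act a eta \in @is_atiyah _ _ (fcst U) (F U).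
Proof.
apply/is_atiyahP; split; first exact: act_klinear.
by exists eta => f m; rewrite act_leibniz addrC.
Qed.
Definition lie_map (a : infeq) (U : affineOpen X) (eta : Theta U) : atiyah U :=
  MkAt (lie_map_subproof a eta).

(* A map of sheaves [Theta -> At F] is given by its values on affine opens,
   which form a basis of the topology. *)
Definition sheaf_diffop_le (n : nat)
    (L : forall U : affineOpen X, Theta U -> atiyah U) :=
  forall U : affineOpen X, diffop_le (fcst U) n (L U).

End Sheaves.

(* Main.v *)
Require Import Defs.
From HB Require Import structures.
From mathcomp Require Import all_boot all_order all_algebra.
From mathcomp Require Import ring zify.
From mathcomp Require Import all_classical topology.

Set Implicit Arguments.
Unset Strict Implicit.
Unset Printing Implicit Defensive.

Import GRing.Theory.
Local Open Scope classical_set_scope.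
Local Open Scope ring_scope.

(* At a general closed point x, with maximal ideal m in the ring B of an affine
   open, the vector fields vanishing at x act on the fibre of F, which is k^r:
   this is a finite-dimensional representation R of a Lie algebra. Evaluated at
   x, the iterated commutator [..[L, f_0], .., f_n] (eta) is
   R ((f_0 - f_0 x) .. (f_n - f_n x) eta), so it suffices that R kills
   m^(r^2 + 1) Theta.

   First, R kills m^N Theta for some N: the kernel contains some u xi with u <> 0
   by finite dimension; brackets turn it into q Theta with q <> 0; and the
   functions c such that R kills c m^N Theta for large N form an ideal stable
   under all derivations, hence contain 1, because B has no proper nonzero stable
   ideal (an Euler field shows that a stable ideal inside m lies in every m^N,
   and Krull's theorem applies). The same simplicity makes F torsion free.

   Next, let n be maximal such that R does not kill m^n Theta. By polarization
   R (t^n X) <> 0 for some t in m; then t is not in m^2 and there is a field xi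
   with xi t = 1 at x. The brackets of the t^a xi with the t^b X for a + b = n + 1
   are nonzero multiples of R (t^n X), except possibly when a = b, so that the
   identity and the R (t^b X) for 1 <= b <= n, b <> (n + 1) / 2, are linearly
   independent matrices of size r: hence n <= r^2. *)

(** * Noetherian rings *)

Definition ideal {R : comPzRingType} (I : set R) :=
  [/\ I 0, forall x y, I x -> I y -> I (x + y) & forall a x, I x -> I (a * x)].

Section IdealTheory.
Context {R : comPzRingType} {I : set R} (idI : ideal I).

Lemma ideal0 : I 0. Proof. by case: idI. Qed.
Lemma idealD x y : I x -> I y -> I (x + y).
Proof. by case: idI => _ h _; exact: h. Qed.
Lemma idealM a x : I x -> I (a * x).
Proof. by case: idI => _ _; exact. Qed.
Lemma idealMr a x : I x -> I (x * a).
Proof. by rewrite mulrC; exact: idealM. Qed.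
Lemma idealN x : I x -> I (- x).
Proof. by move=> Ix; rewrite -mulN1r; exact: idealM. Qed.
Lemma idealB x y : I x -> I y -> I (x - y).
Proof. by move=> Ix Iy; apply: idealD => //; exact: idealN. Qed.
Lemma idealX x n : I x -> (0 < n)%N -> I (x ^+ n).
Proof. by case: n => // n Ix _; rewrite exprS; exact: idealMr. Qed.
Lemma ideal_sum (J : Type) (r : seq J) (P : pred J) (F : J -> R) :
  (forall i, P i -> I (F i)) -> I (\sum_(i <- r | P i) F i).
Proof. by move=> h; apply: big_ind => //; [exact: ideal0|exact: idealD]. Qed.

End IdealTheory.

Definition ideal_gen {R : comPzRingType} (S : set R) : set R :=
  [set x | forall J, ideal J -> S `<=` J -> J x].

Lemma ideal_genP {R : comPzRingType} (S : set R) : ideal (ideal_gen S).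
Proof.
split=> [J iJ _|x y Ix Iy J iJ SJ|a x Ix J iJ SJ].
- exact: ideal0 iJ.
- by apply: (idealD iJ); [exact: Ix|exact: Iy].
- by apply: (idealM iJ); exact: Ix.
Qed.

Lemma sub_ideal_gen {R : comPzRingType} (S : set R) : S `<=` ideal_gen S.
Proof. by move=> x Sx J _; apply. Qed.

Lemma ideal_gen_sub {R : comPzRingType} (S J : set R) :
  ideal J -> S `<=` J -> ideal_gen S `<=` J.
Proof. by move=> iJ SJ x; apply. Qed.

Lemma ideal_gen_mono {R : comPzRingType} (S T : set R) :
  S `<=` T -> ideal_gen S `<=` ideal_gen T.
Proof.
move=> ST; apply: ideal_gen_sub (ideal_genP T) _.
exact: subset_trans ST (@sub_ideal_gen _ _).
Qed.

(** The ascending chain condition, stated on sequences because both Hilbert's basis theorem and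
    Krull's theorem use it in this form. *)
Definition noetherian (R : comPzRingType) := forall P : nat -> R,
  exists N, ideal_gen [set P i | i in [set i | (i < N)%N]] (P N).

Lemma noetherian_field (k : fieldType) : noetherian k.
Proof.
move=> P; have [P0|/existsNP[i Pi]] := pselect (forall i, P i = 0).
  by exists 0%N; rewrite P0; exact: ideal0 (ideal_genP _).
exists i.+1 => J iJ SJ; rewrite -[P i.+1](divfK (introN eqP Pi)).
by apply: (idealM iJ); apply: SJ; exists i => /=.
Qed.

(** Hilbert's basis theorem. In the ideal [A] generated by a bad sequence [P], polynomials [f j] of
    least degree are chosen, each outside the ideal of its predecessors; a relation between their
    leading coefficients contradicts minimality. *)
Lemma noetherian_poly (R : comNzRingType) : noetherian R -> noetherian {poly R}.
Proof.
move=> noR P; apply: contrapT => /forallNP noP.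
pose init (f : nat -> {poly R}) n := ideal_gen [set f i | i in [set i | (i < n)%N]].
have init_mono f n p : (n <= p)%N -> init f n `<=` init f p.
  by move=> np; apply: ideal_gen_mono => _ [i ni <-]; exists i => //=;
    exact: leq_trans np.
pose A := [set q | exists n, init P n q].
have idA : ideal A.
  split=> [|x y [n nx] [p py]|a x [n nx]]; first by exists 0%N;
    exact: ideal0 (ideal_genP _).
    exists (maxn n p); apply: (idealD (ideal_genP _)).
      by apply: init_mono nx; rewrite leq_maxl.
    by apply: init_mono py; rewrite leq_maxr.
  by exists n; apply: (idealM (ideal_genP _)).
(* The inclusion in [A] is a premise under the existential so that [choice] yields a total function;
   lists not contained in [A] get the value 0. *)
have new (s : seq {poly R}) : exists q, [set` s] `<=` A ->
    [/\ A q, ~ ideal_gen [set` s] q &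
      forall q', A q' -> ~ ideal_gen [set` s] q' -> (size q <= size q')%N].
  have [sA|sA] := pselect ([set` s] `<=` A); last by exists 0 => /sA.
  suff [q0 [Aq0 nq0]] : exists q, A q /\ ~ ideal_gen [set` s] q.
    have ex : exists n, `[< exists2 q, A q /\ ~ ideal_gen [set` s] q & size q = n >].
      by exists (size q0); apply/asboolP; exists q0.
    case: (ex_minnP ex) => n /asboolP[q [Aq nq] sq] min.
    exists q => _; split=> // q' Aq' nq'; rewrite sq.
    by apply: min; apply/asboolP; exists q'.
  apply: contrapT => /forallNP h.
  have [n sn] : exists n, [set` s] `<=` init P n.
    elim: s {h} sA => [|x s IHs] sA; first by exists 0%N.
    have [|n sn] := IHs; first by move=> y ys; apply: sA;
      rewrite /= inE ys orbT.
    have [p px] : A x by apply: sA; rewrite /= inE eqxx.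
    exists (maxn n p) => y /=; rewrite inE => /orP[/eqP->|ys].
      by apply: init_mono px; rewrite leq_maxr.
    by apply: init_mono (sn _ ys); rewrite leq_maxl.
  apply: (noP n); have AP : A (P n) by exists n.+1; apply: sub_ideal_gen;
    exists n => /=.
  have : ideal_gen [set` s] (P n) by apply: contrapT => ?; exact: (h (P n)).
  exact: ideal_gen_sub (ideal_genP _) sn _.
have [G GP] := choice new.
pose sq j := iter j (fun s => rcons s (G s)) [::].
pose f j := G (sq j).
have sqE j : [set` sq j] = [set f i | i in [set i | (i < j)%N]].
  elim: j => [|j IHj]; first by apply/seteqP; split=> [x|x [i]].
  apply/seteqP; split=> [x|_ [i /= ij <-]] /=.
    rewrite mem_rcons inE => /orP[/eqP->|xs]; first by exists j => /=.
    have : [set` sq j] x := xs.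
    by rewrite IHj => -[i /= ij <-]; exists i => //=; exact: ltnW.
  rewrite mem_rcons inE; move: ij; rewrite ltnS leq_eqVlt => /orP[/eqP->|ij].
    by rewrite eqxx.
  apply/orP; right; suff : [set` sq j] (f i) by [].
  by rewrite IHj; exists i.
have sqA j : [set` sq j] `<=` A.
  elim: j => [//|j IHj] x /=; rewrite mem_rcons inE => /orP[/eqP->|];
    last exact: IHj.
  by have [] := GP _ IHj.
have fA j : A (f j) by have [] := GP _ (sqA j).
have fN j : ~ init f j (f j) by rewrite /init -sqE; have [] := GP _ (sqA j).
have fmin j q : A q -> ~ init f j q -> (size (f j) <= size q)%N.
  by rewrite /init -sqE; have [_ _] := GP _ (sqA j); exact.
have [N leadN] := noR (fun j => lead_coef (f j)).
have sfN : (0 < size (f N))%N.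
  rewrite lt0n size_poly_eq0; apply/eqP => f0; apply: (fN N).
  by rewrite f0; exact: ideal0 (ideal_genP _).
(* Powers of ['X] raise the earlier [f i] to the degree of [f N], so the relation between leading
   coefficients lifts to a polynomial [q]. *)
have [q [Iq sq' qE]] : exists q,
    [/\ init f N q, (size q <= size (f N))%N & q`_(size (f N)).-1 = lead_coef (f N)].
  have idf : ideal (init f N) := ideal_genP _.
  apply: (leadN [set c | exists q, [/\ init f N q, (size q <= size (f N))%N
                        & q`_(size (f N)).-1 = c]]).
    split=> [|_ _ [p [Ip sp <-]] [q [Iq sq' <-]]|a _ [p [Ip sp <-]]].
    - by exists 0; split; [exact: ideal0 idf|rewrite size_poly0|rewrite coef0].
    - exists (p + q); split; [exact: (idealD idf)| |by rewrite coefD].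
      by apply: leq_trans (size_polyD _ _) _; rewrite geq_max sp.
    - exists (a%:P * p); split; [exact: (idealM idf)| |by rewrite coefCM].
      by rewrite mul_polyC; apply: leq_trans (size_scale_leq _ _) _.
  move=> _ [i /= iN <-].
  have le_s : (size (f i) <= size (f N))%N.
    apply: fmin => // h; apply: (fN N); apply: init_mono h; exact: ltnW.
  have si : (0 < size (f i))%N.
    rewrite lt0n size_poly_eq0; apply/eqP => f0; apply: (fN i).
    by rewrite f0; exact: ideal0 (ideal_genP _).
  exists ('X^(size (f N) - size (f i)) * f i); split.
  - by apply: (idealM idf); apply: sub_ideal_gen; exists i.
  - rewrite mulrC; apply: leq_trans (size_polyMleq _ _) _.
    by rewrite size_polyXn addnS /= subnKC.
  - have le_s' : (size (f N) - size (f i) <= (size (f N)).-1)%N.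
      by rewrite -subn1; exact: leq_sub2l.
    rewrite coefXnM ltnNge le_s' /= lead_coefE; congr (_`_ _).
    by rewrite -!subn1 subnAC subKn.
have iA : init f N `<=` A.
  by apply: ideal_gen_sub idA _ => _ [i _ <-].
(* The leading terms cancel; minimality then puts [f N - q], hence [f N], in the ideal of its
   predecessors. *)
have sfq : (size (f N - q)%R < size (f N))%N.
  rewrite -(ltn_predK sfN) ltnS; apply/leq_sizeP => j.
  rewrite leq_eqVlt => /orP[/eqP<-|jN];
    first by rewrite coefB qE lead_coefE subrr.
  have sj : (size (f N) <= j)%N by rewrite -(ltn_predK sfN).
  by rewrite coefB !nth_default ?subrr //; exact: leq_trans sj.
have := fmin N (f N - q); rewrite leqNgt sfq => fm.
suff : false by [].
apply: fm; first by apply: (idealB idA) => //; exact: iA.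
by move=> /(idealD (ideal_genP _))/(_ Iq); rewrite subrK; exact: fN.
Qed.

(** * Closed points of finitely generated algebras *)

Section PrimeIdeals.
Context {R : comPzRingType} {P : set R} (prP : prime_ideal P).

Lemma prime_ideal_ideal : ideal P.
Proof. by case: prP => P0 _ PD PM _; split=> // a x; exact: PM. Qed.

Lemma prime_idealM x y : ~ P x -> ~ P y -> ~ P (x * y).
Proof. by case: prP => _ _ _ _ PI Px Py /PI[]. Qed.

Lemma prime_idealX x n : ~ P x -> ~ P (x ^+ n).
Proof.
move=> Px; elim: n => [|n IHn]; first by rewrite expr0; case: prP.
by rewrite exprS; exact: prime_idealM.
Qed.

End PrimeIdeals.

Lemma preimage_prime (R S : comPzRingType) (f : {rmorphism R -> S}) (P : set S) :
  prime_ideal P -> prime_ideal (f @^-1` P).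
Proof.
move=> [P0 P1 PD PM PI]; split; rewrite /preimage /=.
- by rewrite rmorph0.
- by rewrite rmorph1.
- by move=> x y Px Py; rewrite rmorphD; exact: PD.
- by move=> x y Py; rewrite rmorphM; exact: PM.
- by move=> x y; rewrite rmorphM; exact: PI.
Qed.

(** The Nullstellensatz as a property of a ring: rational points are dense in every irreducible
    closed subset. Asking it for all primes makes it pass to [{poly R}]. *)
Definition has_points (k : fieldType) (R : comPzRingType) (j : {rmorphism k -> R}) :=
  forall (P : set R) (q : R), prime_ideal P -> ~ P q ->
  exists chi : {rmorphism R -> k},
    [/\ forall c, chi (j c) = c, forall x, P x -> chi x = 0 & chi q != 0].

Lemma has_points_field (k : fieldType) : has_points (idfun : {rmorphism k -> k}).
Proof.
move=> P q prP Pq; exists idfun; split=> //= [x Px|].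
  apply/eqP/negPn/negP => x0; case: prP => _ P1 _ PM _; apply: P1.
  by rewrite -(mulVf x0); exact: PM.
by apply/eqP => q0; apply: Pq; rewrite q0; case: prP.
Qed.

Lemma size_drop_lead (R : nzRingType) (p : {poly R}) : p != 0 ->
  (size (p - lead_coef p *: 'X^((size p).-1))%R < size p)%N.
Proof.
rewrite -size_poly_gt0 => p_gt0; rewrite -[ltnRHS](ltn_predK p_gt0) ltnS.
apply/leq_sizeP => j; rewrite leq_eqVlt coefB coefZ coefXn => /orP[/eqP<-|jp].
  by rewrite eqxx mulr1 lead_coefE subrr.
by rewrite gtn_eqF // mulr0 subr0 nth_default // -(ltn_predK p_gt0).
Qed.

Lemma coef_drop_lead (R : nzRingType) (p : {poly R}) i : i != (size p).-1 ->
  (p - lead_coef p *: 'X^((size p).-1))`_i = p`_i.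
Proof. by move=> ip; rewrite coefB coefZ coefXn (negbTE ip) mulr0 subr0. Qed.

(** Modulo [P], [h] is a nonzero polynomial of least degree in the image of [A]. If its leading
    coefficient were in [P], dropping the leading term would give a smaller one. *)
Lemma ideal_min_lead (R : comNzRingType) (P : set R) (A : set {poly R}) :
  ideal P -> ideal A -> (forall c, P c -> A c%:P) ->
  (exists h i, A h /\ ~ P h`_i) ->
  exists h, [/\ A h, ~ P (lead_coef h) &
    forall p, A p -> (size p < size h)%N -> forall i, P p`_i].
Proof.
move=> idP idA PA [h0 [i0 [Ah0 Pi0]]].
have ex : exists n, `[< exists h i, [/\ A h, ~ P h`_i & size h = n] >].
  by exists (size h0); apply/asboolP; exists h0, i0.
case: (ex_minnP ex) => n /asboolP[h [i [Ah Pi sh]]] min.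
have small p : A p -> (size p < size h)%N -> forall i, P p`_i.
  move=> Ap sp l; apply: contrapT => Pl.
  have := min (size p); rewrite -sh leqNgt sp => m.
  by suff : false by []; apply: m; apply/asboolP; exists p, l.
have h_neq0 : h != 0.
  by apply/eqP => h0'; apply: Pi; rewrite h0' coef0; exact: ideal0 idP.
exists h; split=> // Pl; apply: Pi.
have [ih|il] := eqVneq i (size h).-1; first by rewrite ih -lead_coefE.
rewrite -(coef_drop_lead il); apply: small; last exact: size_drop_lead.
by apply: (idealB idA) => //; rewrite -mul_polyC; apply: (idealMr idA);
  exact: PA.
Qed.

Lemma rmodp_ideal (R : comNzRingType) (I : set {poly R}) (p d : {poly R}) :
  ideal I -> I p -> I d -> I (Pdiv.Ring.rmodp p d).
Proof.
move=> idI Ip Id.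
rewrite (canRL (addKr _) (esym (Pdiv.ComRing.rdivp_eq d p))) addrC -mul_polyC.
by apply: (idealB idI); apply: (idealM idI).
Qed.

(** Let [P] be the contraction of [Q] to [R]. Either [Q] consists of the polynomials with
    coefficients in [P], and a point of [R] is extended by a nonroot of the image of [q]; or it is
    extended by a root of some [h] in [Q] of least degree modulo [P]. *)
Lemma has_points_poly (k : closedFieldType) (R : comNzRingType)
    (j : {rmorphism k -> R}) :
  has_points j -> has_points (polyC \o j : {rmorphism k -> {poly R}}).
Proof.
move=> ptR Q q prQ Qq; have idQ := prime_ideal_ideal prQ.
pose P := (polyC : {rmorphism R -> {poly R}}) @^-1` Q.
have prP : prime_ideal P := preimage_prime _ prQ.
have idP := prime_ideal_ideal prP.
pose ext (chi : {rmorphism R -> k}) a : {rmorphism {poly R} -> k} :=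
  horner_eval a \o map_poly chi.
have extE chi a p : ext chi a p = (map_poly chi p).[a] by [].
have extC chi a c : ext chi a c%:P = chi c by rewrite extE map_polyC hornerC.
have extD chi a p p' : ext chi a (p + p') = ext chi a p + ext chi a p'.
  exact: rmorphD.
have extM chi a p p' : ext chi a (p * p') = ext chi a p * ext chi a p'.
  exact: rmorphM.
have coefP (p : {poly R}) : (forall i, P p`_i) -> Q p.
  move=> Pp; rewrite -[p]coefK poly_def; apply: (ideal_sum idQ) => i _.
  by rewrite -mul_polyC; apply: (idealMr idQ); exact: Pp.
have kill (chi : {rmorphism R -> k}) (p : {poly R}) :
    (forall x, P x -> chi x = 0) -> (forall i, P p`_i) -> map_poly chi p = 0.
  by move=> chiP Pp; apply/polyP => i; rewrite coef_map coef0 /=; exact: chiP.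
have [QP|/existsNP[h0 /not_implyP[Qh0 /existsNP[i0 Pi0]]]] :=
    pselect (forall p, Q p -> forall i, P p`_i).
  have [i Pi] : exists i, ~ P q`_i.
    by apply/existsNP => /coefP.
  have [chi [chij chiP chii]] := ptR _ _ prP Pi.
  have : map_poly chi q != 0.
    by apply: contraNneq chii => q0; rewrite -coef_map q0 coef0.
  move=> /closed_nonrootP[a qa]; exists (ext chi a); split=> // [c|x Qx].
    exact: etrans (extC _ _ _) (chij c).
  by rewrite extE (kill chi) ?horner0 //; exact: QP.
have [h [Qh lh minh]] := @ideal_min_lead _ P Q idP idQ (fun c => id)
  (ex_intro _ h0 (ex_intro _ i0 (conj Qh0 Pi0))).
(* The ideal generated by [Q] and [q]. The aim is a constant [e] outside [P] in it: a point killing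
   [Q] but not [e] cannot kill [q]. *)
pose Q2 := [set p | exists a b, Q b /\ p = a * q + b].
have QQ2 : Q `<=` Q2 by move=> p Qp; exists 0, p; rewrite mul0r add0r.
have idQ2 : ideal Q2.
  split=> [|_ _ [a [b [Qb ->]]] [c [d [Qd ->]]]|x _ [a [b [Qb ->]]]].
  - exact/QQ2/(ideal0 idQ).
  - by exists (a + c), (b + d); split; [exact: (idealD idQ)|ring].
  - by exists (x * a), (x * b); split; [exact: (idealM idQ)|ring].
have Q2q : Q2 q by exists 1, 0; split; [exact: ideal0 idQ|ring].
have [h2 [Q2h2 lh2 minh2]] := @ideal_min_lead _ P Q2 idP idQ2 (fun c Pc => QQ2 _ Pc)
  (ex_intro _ h0 (ex_intro _ i0 (conj (QQ2 _ Qh0) Pi0))).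
have nz (p : {poly R}) : ~ P (lead_coef p) -> p != 0.
  by move=> lp; apply/eqP => p0; apply: lp; rewrite p0 lead_coef0;
    exact: ideal0 idP.
have Qlead (p r : {poly R}) n : ~ P (lead_coef p) -> Q (lead_coef p ^+ n *: r) -> Q r.
  move=> lp; rewrite -mul_polyC; case: (prQ) => _ _ _ _ PI /PI[] //.
  by move=> Qp; case: (prime_idealX prP lp Qp).
(* Otherwise pseudo-division of [h] by [h2] leaves a remainder in [Q], so by primality the quotient
   or [h2] is in [Q]; both are impossible. *)
have szh2 : (size h2 <= 1)%N.
  rewrite leqNgt; apply/negP => sz2.
  have mod2 p : Q2 p -> Q (Pdiv.Ring.rmodp p h2).
    move=> Q2p; apply: coefP; apply: minh2;
      last by rewrite Pdiv.Ring.ltn_rmodpN0 ?nz.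
    exact: rmodp_ideal.
  have Qh2N : ~ Q h2.
    move=> Qh2; apply: Qq; apply: (Qlead h2 _ (Pdiv.Ring.rscalp q h2)) => //.
    rewrite Pdiv.ComRing.rdivp_eq; apply: (idealD idQ); last exact: mod2.
    exact: (idealM idQ).
  have [] : Q (Pdiv.Ring.rdivp h h2) \/ Q h2.
  - case: (prQ) => _ _ _ _; apply.
    rewrite (canRL (addrK _) (esym (Pdiv.ComRing.rdivp_eq h2 h))) -mul_polyC.
    by apply: (idealB idQ); [exact: (idealM idQ)|exact/mod2/QQ2].
  - set a := Pdiv.Ring.rdivp h h2 => Qa.
    set r := Pdiv.Ring.rmodp h h2; have sr : (size r < size h2)%N.
      by rewrite Pdiv.Ring.ltn_rmodpN0 ?nz.
    have := Pdiv.ComRing.rdivp_eq h2 h; rewrite -/a -/r => divE.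
    have Pr i : P r`_i by apply: minh2 => //; apply: rmodp_ideal => //;
      exact: QQ2.
    (* With zero divisors in [R], [a] may be as long as [h]. As [h2] is not constant, the top
       coefficient of [a * h2] is then, up to sign, a coefficient of [r]. *)
    have Pla : P (lead_coef a).
      have [sa|] := ltnP (size a) (size h); first exact: minh sa _.
      have le_sa : (size a <= size h)%N by exact: Pdiv.Ring.leq_rdivp.
      move=> ge_sa; have sa : size a = size h by apply/eqP;
        rewrite eqn_leq le_sa.
      have : P (lead_coef a * lead_coef h2).
        rewrite mul_lead_coef -[a * h2](addrK r) -divE coefB coefZ.
        rewrite [h`__]nth_default;
          last by rewrite sa -subn2 -addnBA // leq_addr.
        by rewrite mulr0 sub0r; exact: (idealN idP).
      by case: (prP) => _ _ _ _ PI /PI[].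
    have Pa i : P a`_i.
      have [->|a0] := eqVneq a 0; first by rewrite coef0; exact: (ideal0 idP).
      have [->|ia] := eqVneq i (size a).-1; first by rewrite -lead_coefE.
      rewrite -(coef_drop_lead ia); apply: minh.
        by apply: (idealB idQ) => //; rewrite -mul_polyC; apply: (idealMr idQ).
      apply: leq_trans (size_drop_lead a0) _; exact: Pdiv.Ring.leq_rdivp.
    have : P (lead_coef h2 ^+ Pdiv.Ring.rscalp h h2 * lead_coef h).
      rewrite lead_coefE -coefZ divE coefD; apply: (idealD idP) => //.
      by rewrite coefM; apply: (ideal_sum idP) => i _; apply: (idealMr idP).
    by apply: prime_idealM => //; exact: prime_idealX.
  - exact: Qh2N.
have [e [Pe [a [b [Qb qE]]]]] : exists e, ~ P e /\ Q2 e%:P.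
  by exists (lead_coef h2); split=> //;
    rewrite (size1_polyC szh2) lead_coefC -(size1_polyC szh2).
have [chi [chij chiP chice]] := ptR _ _ prP (prime_idealM prP lh Pe).
have [chic chie] : chi (lead_coef h) != 0 /\ chi e != 0.
  by move: chice; rewrite rmorphM mulf_eq0 negb_or => /andP.
(* The leading coefficient of [h] survives [chi], and [h] is not constant because a constant in [Q]
   is in [P]; so the image of [h] has a root. *)
have : size (map_poly chi h) != 1%N.
  rewrite size_map_poly_id0 //; apply/eqP => sh; apply: lh.
  have Qc : Q h by []; rewrite (size1_polyC (eq_leq sh)) in Qc.
  by rewrite (size1_polyC (eq_leq sh)) lead_coefC.
move=> /closed_rootP[x /rootP hx]; have extQ p : Q p -> ext chi x p = 0.
  move=> Qp; set r := Pdiv.Ring.rmodp p h.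
  have sr : (size r < size h)%N by rewrite Pdiv.Ring.ltn_rmodpN0 ?nz.
  have divE : _ = _ + r := Pdiv.ComRing.rdivp_eq h p.
  have Qr : Q r by exact: rmodp_ideal.
  have : ext chi x (lead_coef h ^+ Pdiv.Ring.rscalp p h *: p) = 0.
    rewrite divE extD extM !extE hx mulr0 add0r.
    by rewrite (kill chi) ?horner0 //; exact: minh Qr sr.
  rewrite -mul_polyC extM extC => /eqP; rewrite mulf_eq0 rmorphXn.
  by rewrite expf_eq0 (negbTE chic) andbF => /eqP.
exists (ext chi x); split=> // [c|]; first exact: etrans (extC _ _ _) (chij c).
apply: contraNneq chie => qx.
by rewrite -(extC chi x) qE extD extM qx mulr0 add0r extQ.
Qed.

Lemma exists_rmorphism (A C : pzRingType) (f : A -> C) :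
  f 1 = 1 -> (forall x y, f (x + y) = f x + f y) ->
  (forall x y, f (x * y) = f x * f y) -> exists F : {rmorphism A -> C}, F =1 f.
Proof.
move=> f1 fD fM; have f0 : f 0 = 0 by apply: (addrI (f 0)); rewrite -fD !addr0.
have fB : {morph f : x y / x - y}.
  by move=> x y; apply/eqP; rewrite eq_sym subr_eq -fD subrK.
pose F : GRing.RMorphism.type A C := HB.pack f
  (GRing.isZmodMorphism.Build _ _ f fB)
  (GRing.isMonoidMorphism.Build _ _ f (conj f1 fM)).
by exists F.
Qed.

(** [R] is a polynomial ring with one variable for each element of [s], and [psi] is evaluation at
    [s]; the last two clauses say that its image is the subalgebra generated by [s]. *)
Lemma exists_presentation (k : closedFieldType) (S : comNzRingType)
    (iota : {rmorphism k -> S}) (s : seq S) :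
  exists (R : comNzRingType) (j : {rmorphism k -> R}) (psi : {rmorphism R -> S}),
    [/\ noetherian R, has_points j, forall c, psi (j c) = iota c,
      forall x, x \in s -> exists y, psi y = x &
      forall T : set S, (forall c, T (iota c)) -> (forall x, x \in s -> T x) ->
        (forall x y, T x -> T y -> T (x + y)) ->
        (forall x y, T x -> T y -> T (x * y)) -> forall y, T (psi y)].
Proof.
elim: s => [|a s [R [j [psi [noR ptR psij psis psiT]]]]].
  exists k, idfun, iota; split=> //; first exact: noetherian_field.
  exact: has_points_field.
pose psi' : {rmorphism {poly R} -> S} := horner_eval a \o map_poly psi.
have psi'E p : psi' p = (map_poly psi p).[a] by [].
have psi'C c : psi' c%:P = psi c by rewrite psi'E map_polyC hornerC.
exists {poly R}, (polyC \o j), psi'; split.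
- exact: noetherian_poly.
- exact: has_points_poly.
- by move=> c; rewrite -psij -psi'C.
- move=> x; rewrite inE => /orP[/eqP->|/psis[y <-]]; last by exists y%:P.
  by exists 'X; rewrite psi'E map_polyX hornerX.
- move=> T Tc Ts TD TM; elim/poly_ind => [|p c Tp].
    by rewrite rmorph0 -(rmorph0 iota).
  have -> : psi' (p * 'X + c%:P) = psi' p * a + psi c.
    by rewrite -psi'C !psi'E !rmorphD rmorphM /= map_polyX map_polyC !hornerE.
  apply: (TD); first by apply: TM Tp _; apply: Ts; rewrite inE eqxx.
  by apply: psiT => // x xs; apply: Ts; rewrite inE xs orbT.
Qed.

Section FinitelyGenerated.
Context {k : closedFieldType} {B : comNzRingType} (iota : {rmorphism k -> B}).
Hypothesis fgB : fg_algebra iota.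

(** The preimage of [P] contains the kernel of [psi], so the point found on [R] factors through [B];
    [g] is only a set-theoretic section. *)
Lemma fg_has_points : has_points iota.
Proof.
have [s sB] := fgB.
have [R [j [psi [_ ptR psij psis _]]]] := exists_presentation iota s.
have surj b : exists y, psi y = b.
  apply: (sB [set b | exists y, psi y = b])
    => [c|//|_ _ [x <-] [y <-]|_ _ [x <-] [y <-]].
  - by exists (j c).
  - by exists (x + y); rewrite rmorphD.
  - by exists (x * y); rewrite rmorphM.
have [g gK] := choice surj.
move=> P q prP Pq;
  have [chi [chij chiP chiq]] : exists chi : {rmorphism R -> k},
    [/\ forall c, chi (j c) = c, forall x, P (psi x) -> chi x = 0 & chi (g q) != 0].
  by apply: ptR; [exact: preimage_prime|rewrite /preimage /= gK].
have chiE y : chi (g (psi y)) = chi y.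
  apply/eqP; rewrite -subr_eq0 -rmorphB chiP // rmorphB gK subrr.
  by case: prP.
have [f fE] : exists f : {rmorphism B -> k}, f =1 chi \o g.
  apply: exists_rmorphism => [|x y|x y] /=.
  - by rewrite -(rmorph1 psi) chiE rmorph1.
  - by rewrite -{1}(gK x) -{1}(gK y) -rmorphD chiE rmorphD.
  - by rewrite -{1}(gK x) -{1}(gK y) -rmorphM chiE rmorphM.
exists f; split=> [c|x Px|]; rewrite fE //=.
- by rewrite -psij chiE.
- by apply: chiP; rewrite gK.
Qed.

End FinitelyGenerated.

(** * Integral domains and powers of an ideal *)

Definition is_domain (B : comPzRingType) :=
  (1 : B) <> 0 /\ forall f g : B, f * g = 0 -> f = 0 \/ g = 0.

Definition ideal_pow {B : comPzRingType} (m : set B) (n : nat) : set B :=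
  iter n (fun J => ideal_gen [set a * b | a in m & b in J]) [set: B].
Arguments ideal_pow {B} m n : simpl never.

Section IdealPowers.
Context {B : comPzRingType} (m : set B).
Local Notation mpow := (ideal_pow m).

Lemma ideal_powP n : ideal (mpow n).
Proof. by case: n => [|n]; [split|exact: ideal_genP]. Qed.

Lemma ideal_powMl n a b : m a -> mpow n b -> mpow n.+1 (a * b).
Proof. by move=> ma mb; apply: sub_ideal_gen; exists a => //; exists b. Qed.

(** The induction rule for powers: [J] is the property to be proved. *)
Lemma ideal_powS_sub n (J : set B) : ideal J ->
  (forall a b, m a -> mpow n b -> J (a * b)) -> mpow n.+1 `<=` J.
Proof. by move=> iJ h; apply: ideal_gen_sub => // _ [a ma [b mb <-]];
  exact: h. Qed.

Lemma ideal_powS n : mpow n.+1 `<=` mpow n.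
Proof.
apply: ideal_powS_sub => [|a b _]; first exact: ideal_powP.
exact: (idealM (ideal_powP n)).
Qed.

Lemma ideal_pow_le n p : (n <= p)%N -> mpow p `<=` mpow n.
Proof.
elim: p => [|p IHp]; first by rewrite leqn0 => /eqP->.
rewrite leq_eqVlt => /orP[/eqP->//|]; rewrite ltnS => /IHp.
exact: subset_trans (@ideal_powS p).
Qed.

Lemma ideal_pow1 a : m a -> mpow 1 a.
Proof. by move=> ma; rewrite -[a]mulr1; exact: ideal_powMl. Qed.

Lemma ideal_powD n p a b : mpow n a -> mpow p b -> mpow (n + p)%N (a * b).
Proof.
move=> ma mb; elim: n a ma => [|n IHn] a ma;
  first exact: (idealM (ideal_powP p)).
suff : mpow n.+1 `<=` [set a | mpow (n.+1 + p)%N (a * b)] by apply.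
have idJ := ideal_powP (n.+1 + p)%N.
apply: ideal_powS_sub => [|c d mc md]; last by rewrite /= -mulrA;
  apply: ideal_powMl => //; exact: IHn.
split=> /= [|x y ? ?|x y ?]; first by rewrite mul0r; exact: (ideal0 idJ).
  by rewrite mulrDl; exact: (idealD idJ).
by rewrite -mulrA; exact: (idealM idJ).
Qed.

Lemma ideal_powX a n : m a -> mpow n (a ^+ n).
Proof. by move=> ma; elim: n => [//|n IHn]; rewrite exprS;
  exact: ideal_powMl. Qed.

Lemma ideal_pow_sub : ideal m -> forall n, mpow n.+1 `<=` m.
Proof. by move=> idm n; apply: ideal_powS_sub => // a b ma _;
  exact: (idealMr idm). Qed.

End IdealPowers.

(** * Krull's intersection theorem at a closed point *)

Definition point_ideal {k : fieldType} {B : comPzRingType}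
    (chi : {rmorphism B -> k}) : set B := [set b | chi b = 0].

Section Point.
Context {k : closedFieldType} {B : comNzRingType} {iota : {rmorphism k -> B}}.
Context {chi : {rmorphism B -> k}} (chi_iota : forall c, chi (iota c) = c).

Local Notation m := (point_ideal chi).
Local Notation mpow := (ideal_pow m).

Lemma point_idealP : ideal m.
Proof.
rewrite /point_ideal; split=> [|x y /= x0 y0|a x /= x0]; first exact: rmorph0.
  by rewrite rmorphD x0 y0 addr0.
by rewrite rmorphM x0 mulr0.
Qed.

Lemma point_ideal_sub b : m (b - iota (chi b)).
Proof. by rewrite /point_ideal /= rmorphB chi_iota subrr. Qed.

(** The Rees algebra, the sum of the [m^n T^n] inside [B[T]], is a quotient of a noetherian ring.
    Applied to the elements [f T^n], this gives [f = f * b] with [b] in [m]. *)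
Lemma krull_intersection : is_domain B -> fg_algebra iota ->
  forall f, (forall n, mpow n f) -> f = 0.
Proof.
move=> [_ domB] [s sB] f fm.
(* Generators of the Rees algebra: those of [B] in degree 0, and in degree 1 the same ones shifted
   to vanish at the point. *)
pose G := [seq x%:P | x <- s] ++ [seq (x - iota (chi x))%:P * 'X | x <- s].
have [R [j [psi [noR _ psij psiG psiT]]]] :=
  exists_presentation (polyC \o iota : {rmorphism k -> {poly B}}) G.
have rangeD (p q : {poly B}) :
    (exists y, psi y = p) -> (exists y, psi y = q) -> exists y, psi y = p + q.
  by move=> [x <-] [y <-]; exists (x + y); rewrite rmorphD.
have rangeM (p q : {poly B}) :
    (exists y, psi y = p) -> (exists y, psi y = q) -> exists y, psi y = p * q.
  by move=> [x <-] [y <-]; exists (x * y); rewrite rmorphM.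
have rangeC b : exists y, psi y = b%:P.
  apply: (sB [set b | exists y, psi y = b%:P]) => [c|x xs|x y Px Py|x y Px Py] /=.
  - by exists (j c); rewrite psij.
  - by apply: psiG; rewrite mem_cat map_f.
  - by rewrite polyCD; exact: rangeD.
  - by rewrite polyCM; exact: rangeM.
have rangeX b : exists y, psi y = (b - iota (chi b))%:P * 'X.
  apply: (sB [set b | exists y, psi y = (b - iota (chi b))%:P * 'X])
    => [c|x xs|x y Px Py|x y Px Py] /=.
  - by exists 0; rewrite chi_iota subrr rmorph0 mul0r.
  - by apply: psiG;
    rewrite mem_cat (map_f (fun x => (x - iota (chi x))%:P * 'X)) ?orbT.
  - have -> : x + y - iota (chi (x + y)) =
        (x - iota (chi x)) + (y - iota (chi y)) by rewrite !rmorphD /=; ring.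
    rewrite polyCD mulrDl; exact: rangeD.
  - have -> : x * y - iota (chi (x * y)) =
        x * (y - iota (chi y)) + iota (chi y) * (x - iota (chi x)).
      by rewrite !rmorphM /=; ring.
    rewrite polyCD !polyCM mulrDl -!mulrA.
    by apply: (rangeD); apply: (rangeM).
have rangeXn n b : mpow n b -> exists y, psi y = b%:P * 'X^n.
  elim: n b => [|n IHn] b; first by rewrite mulr1.
  move: b; apply: ideal_powS_sub => [|a b ma mb].
    split=> [|x y Px Py|a x Px] /=; first by exists 0; rewrite rmorph0 mul0r.
      by rewrite polyCD mulrDl; exact: rangeD.
    by rewrite polyCM -mulrA; exact: rangeM.
  rewrite /= polyCM exprS mulrACA; apply: (rangeM); last exact: IHn.
  by have := rangeX a; rewrite (_ : chi a = 0) // rmorph0 subr0.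
have psi_coef y i : (0 < i)%N -> m (psi y)`_i.
  move: y i; apply: (psiT [set p | forall i, (0 < i)%N -> m p`_i])
    => [c i|x|x y Px Py i i0|x y Px Py i i0] /=.
  - by rewrite coefC; case: i => // *; exact: (ideal0 point_idealP).
  - rewrite mem_cat => /orP[] /mapP[b _ ->] [//|i] _.
      by rewrite coefC; exact: (ideal0 point_idealP).
    rewrite coefMX coefC; case: i => [|i] /=; first exact: point_ideal_sub.
    exact: (ideal0 point_idealP).
  - by rewrite coefD; apply: (idealD point_idealP); [exact: Px|exact: Py].
  - rewrite coefM; apply: (ideal_sum point_idealP) => -[l /= li] _.
    have [l0|l0] := posnP l; last by apply: (idealMr point_idealP); exact: Px.
    by rewrite l0 subn0; apply: (idealM point_idealP); exact: Py.
have [y yE] := choice (fun n => rangeXn n f (fm n)).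
have idfJ (J : set B) : ideal J -> ideal [set f * b | b in J].
  move=> idJ; split=> [|_ _ [b Jb <-] [c Jc <-]|a _ [b Jb <-]].
  - by exists 0; rewrite ?mulr0 //; exact: (ideal0 idJ).
  - by exists (b + c); rewrite ?mulrDr //; exact: (idealD idJ).
  - by exists (a * b); [exact: (idealM idJ)|rewrite mulrCA].
have idT : ideal [set: B] by split.
have [N yN] := noR y.
have : [set f * b | b in m] (psi (y N))`_N.
  (* The first condition makes this set an ideal: in a product, a term of a coefficient of index at
     least [N] either contains such a coefficient of the second factor, or takes a factor in [m]
     from the first by [psi_coef]. *)
  suff [_ h] : [set x | (forall l, [set f * b | b in setT] (psi x)`_l) /\
      (forall l, (N <= l)%N -> [set f * b | b in m] (psi x)`_l)] (y N) by exact: h.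
  apply: yN => [|_ [i /= iN <-]].
    split=> [|u v [u1 u2] [v1 v2]|u v [v1 v2]].
    - by rewrite /= rmorph0; split=> l *; rewrite coef0;
        [exact: (ideal0 (idfJ _ idT))|exact: (ideal0 (idfJ _ point_idealP))].
    - rewrite /= rmorphD; split=> [l|l ?]; rewrite coefD;
      first exact: (idealD (idfJ _ idT)).
      by apply: (idealD (idfJ _ point_idealP)); [exact: u2|exact: v2].
    - rewrite /= rmorphM; split=> [l|l Nl]; rewrite coefM.
        by apply: (ideal_sum (idfJ _ idT)) => i _; apply: (idealM (idfJ _ idT)).
      apply: (ideal_sum (idfJ _ point_idealP)) => -[i /= il] _.
      have [i0|i0] := posnP i.
        by rewrite i0 subn0; apply: (idealM (idfJ _ point_idealP)); exact: v2.
      have [b _ <-] := v1 (l - i)%N; rewrite mulrCA.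
      by exists ((psi u)`_i * b) => //; apply: (idealMr point_idealP);
        exact: psi_coef.
  split=> l; rewrite yE coefCM coefXn.
    by exists (l == i)%:R => //; case: eqP.
  move=> Nl; rewrite gtn_eqF; last exact: leq_trans Nl.
  by rewrite mulr0; exact: (ideal0 (idfJ _ point_idealP)).
rewrite yE coefCM coefXn eqxx mulr1 => -[b mb fb].
have /domB[//|/eqP] : f * (b - 1) = 0 by rewrite mulrBr fb mulr1 subrr.
rewrite subr_eq0 => /eqP b1; have := mb;
  rewrite b1 /point_ideal /= rmorph1 => /eqP.
by rewrite oner_eq0.
Qed.

End Point.

(** * Lifting derivations along formally smooth algebras *)

(** The extension of [B] by the square-zero ideal [C], on which [B] acts through [f]. Ring morphisms
    of the form [b |-> (b, d b)] correspond to derivations [d] from [B] to [C]. *)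
Definition sqzero_ext {B C : comPzRingType} (f : {rmorphism B -> C}) : Type :=
  (B * C)%type.

Section SquareZeroExtension.
Context {B C : comPzRingType} (f : {rmorphism B -> C}).
Local Notation E := (sqzero_ext f).
HB.instance Definition _ := GRing.Zmodule.on E.

Definition sqzero_mul (x y : E) : E := (x.1 * y.1, f x.1 * y.2 + f y.1 * x.2).

Fact sqzero_mulA : associative sqzero_mul.
Proof. by move=> x y z; congr pair; rewrite /= ?mulrA // !rmorphM; ring. Qed.
Fact sqzero_mulC : commutative sqzero_mul.
Proof. by move=> x y; congr pair; [rewrite mulrC|rewrite addrC]. Qed.
Fact sqzero_mul1 : left_id ((1, 0) : E) sqzero_mul.
Proof.
by case=> x y; congr pair; rewrite /= ?mul1r // rmorph1 mul1r mulr0 addr0.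
Qed.
Fact sqzero_mulDl : left_distributive sqzero_mul +%R.
Proof. by move=> x y z; congr pair; rewrite /= ?mulrDl // rmorphD /=; ring. Qed.
HB.instance Definition _ := GRing.Zmodule_isComPzRing.Build E
  sqzero_mulA sqzero_mulC sqzero_mul1 sqzero_mulDl.

Lemma sqzeroM (x y : E) : x * y = (x.1 * y.1, f x.1 * y.2 + f y.1 * x.2) :> E.
Proof. by []. Qed.
Lemma sqzeroD (x y : E) : x + y = (x.1 + y.1, x.2 + y.2) :> E.
Proof. by []. Qed.

End SquareZeroExtension.

(** [delta] defines a morphism from [B] to [C], and the dual numbers [A] over [B] map onto [C] with
    square-zero kernel. The second component of a lift to [A] is [eta]. *)
Lemma lift_point_derivation (k : fieldType) (B : comPzRingType)
    (iota : {rmorphism k -> B}) (chi : {rmorphism B -> k}) (delta : B -> k) :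
  formally_smooth iota -> (forall c, chi (iota c) = c) ->
  (forall x y, delta (x + y) = delta x + delta y) ->
  (forall c, delta (iota c) = 0) ->
  (forall x y, delta (x * y) = chi x * delta y + chi y * delta x) ->
  exists eta : Der iota, forall b, chi (eta b) = delta b.
Proof.
move=> smB chiK dD dC dM.
pose A := sqzero_ext (idfun : {rmorphism B -> B}); pose C := sqzero_ext chi.
have d1 : delta 1 = 0 by rewrite -(rmorph1 iota).
have [iotaA iotaAE] : exists i : {rmorphism k -> A}, i =1 (fun c => (iota c, 0)).
  apply: exists_rmorphism => [|x y|x y]; first by rewrite rmorph1.
    by rewrite sqzeroD /= rmorphD addr0.
  by rewrite sqzeroM /= rmorphM !mulr0 addr0.
have [p pE] : exists p : {rmorphism A -> C}, p =1 (fun a => (a.1, chi a.2)).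
  apply: exists_rmorphism => [|x y|x y]; first by rewrite /= rmorph0.
    by rewrite sqzeroD /= rmorphD.
  by rewrite !sqzeroM /= rmorphD !rmorphM.
have [g gE] : exists g : {rmorphism B -> C}, g =1 (fun b => (b, delta b)).
  apply: exists_rmorphism => [|x y|x y]; first by rewrite d1.
    by rewrite sqzeroD /= dD.
  by rewrite sqzeroM /= dM.
have [||c|h [hiota hg]] := smB A C iotaA p _ _ g.
- by case=> b c; exists (b, iota c); rewrite pE /= chiK.
- move=> [a a'] [b b']; rewrite !pE /= => -[-> _] [-> _].
  by rewrite sqzeroM /= !mul0r addr0.
- by rewrite gE iotaAE pE /= dC rmorph0.
have h1 b : (h b).1 = b by have := hg b; rewrite pE gE => -[].
have h2 b : chi (h b).2 = delta b by have := hg b; rewrite pE gE => -[].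
have hE b : h b = (b, (h b).2) by rewrite -{2}(h1 b); case: (h b).
have eta_der : (fun b => (h b).2 : B^o) \in is_derivation iota.
  apply/is_derivationP; split=> [x y|c x|x y].
  - by rewrite rmorphD.
  - by rewrite rmorphM hiota iotaAE sqzeroM /= mulr0 addr0.
  - by rewrite rmorphM hE [h y]hE sqzeroM /= addrC mulrC.
by exists (MkDer eta_der).
Qed.

(** * Derivations and stable ideals *)

Lemma exists_prime_ideal {R : comPzRingType} {I : set R} :
  ideal I -> ~ I 1 -> exists2 P, prime_ideal P & I `<=` P.
Proof.
move=> idI I1.
(* Taking the union with [I] makes the empty set, which is the union of the empty chain, admissible
   for Zorn's lemma. *)
pose proper (A : set R) := ideal (I `|` A) /\ ~ (I `|` A) 1.
have [F FP totF|P [[idP P1] maxP]] := @Zorn_bigcup R proper.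
  split; last by case=> // -[A FA A1]; have [_] := FP _ FA; apply; right.
  split=> [|x y|a x].
  - by left; exact: (ideal0 idI).
  - have inF A z : F A -> (I `|` A) z -> (I `|` \bigcup_(X in F) X) z.
      by move=> FA [Iz|Az]; [left|right; exists A].
    case=> [Ix|[A FA Ax]] [Iy|[C FC Cy]].
    + by left; exact: (idealD idI).
    + have [idC _] := FP _ FC; apply: (inF C _ FC).
      by apply: (idealD idC); [left|right].
    + have [idA _] := FP _ FA; apply: (inF A _ FA).
      by apply: (idealD idA); [right|left].
    + have [idA _] := FP _ FA; have [idC _] := FP _ FC.
      have [AC|CA] := totF _ _ FA FC.
        by apply: (inF C _ FC); apply: (idealD idC); right => //; exact: AC.
      by apply: (inF A _ FA); apply: (idealD idA); right => //; exact: CA.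
  - case=> [Ix|[A FA Ax]]; first by left; exact: (idealM idI).
    have [idA _] := FP _ FA;
      have [|] := idealM idA a (or_intror Ax : (I `|` A) x).
      by left.
    by right; exists A.
exists (I `|` P); last by left.
split=> [||x y|a x|f g fg] //.
- exact: (ideal0 idP).
- exact: (idealD idP).
- exact: (idealM idP).
apply: contrapT => /not_orP[nf ng].
have gen h : ~ (I `|` P) h -> exists a, (I `|` P) (1 - a * h).
  move=> nh; pose J := [set x | exists a, (I `|` P) (x - a * h)].
  have idJ : ideal J.
    split=> [|x y [a xa] [b yb]|c x [a xa]].
    - by exists 0; rewrite mul0r subr0; exact: (ideal0 idP).
    - exists (a + b);
      have -> : x + y - (a + b) * h = (x - a * h) + (y - b * h) by ring.
      exact: (idealD idP).
    - exists (c * a); have -> : c * x - c * a * h = c * (x - a * h) by ring.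
      exact: (idealM idP).
  have PJ : I `|` P `<=` J by move=> x Px; exists 0; rewrite mul0r subr0.
  have Jh : J h by exists 1; rewrite mul1r subrr; exact: (ideal0 idP).
  have IJ : I `|` J = J by apply/seteqP; split=> [x [Ix|//]|x]; [apply: PJ;
    left|right].
  apply: contrapT => nJ1; apply: (maxP J); last by rewrite /proper IJ.
  split=> [x Px|JP]; first by apply: PJ; right.
  by apply: nh; right; exact: JP.
have [a fa] := gen _ nf; have [b gb] := gen _ ng; apply: P1.
have -> : 1 = (1 - a * f) + a * f * (1 - b * g) + a * b * (f * g) by ring.
apply: (idealD idP); last exact: (idealM idP).
by apply: (idealD idP) => //; exact: (idealM idP).
Qed.

Section DerivationTheory.
Context {k : fieldType} {B : comPzRingType} {iota : {rmorphism k -> B}}.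
Implicit Types (eta mu : Der iota) (f g : B).

Lemma derD eta f g : eta (f + g) = eta f + eta g.
Proof. by have /is_derivationP[] := der_funP eta. Qed.
Lemma derM eta f g : eta (f * g) = (eta f : B) * g + f * (eta g : B) :> B.
Proof. by have /is_derivationP[] := der_funP eta. Qed.
Lemma der0 eta : eta 0 = 0.
Proof. by apply: (addrI (eta 0)); rewrite -derD !addr0. Qed.
Lemma derN eta f : eta (- f) = - eta f.
Proof. by apply: (addrI (eta f)); rewrite -derD !subrr der0. Qed.
Lemma der1 eta : eta 1 = 0.
Proof. by apply: (addrI (eta 1 : B));
  rewrite addr0 -{3}[1]mulr1 derM mulr1 mul1r. Qed.
Lemma derX eta f n : eta (f ^+ n.+1) = (f ^+ n * (eta f : B)) *+ n.+1 :> B.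
Proof.
elim: n => [|n IHn]; first by rewrite expr1 expr0 mul1r.
by rewrite exprS derM IHn mulrnAr mulrA -exprS (mulrC (eta f : B)) -mulrS.
Qed.

Lemma der_ext eta mu : eta =1 mu -> eta = mu.
Proof. by move=> h; apply: val_inj; apply/funext. Qed.
Lemma der_scaleE f eta g : (f *: eta) g = f * (eta g : B) :> B.
Proof. by []. Qed.
Lemma der_addE eta mu f : (eta + mu) f = eta f + mu f.
Proof. by []. Qed.
Lemma der_oppE eta f : (- eta) f = - eta f.
Proof. by []. Qed.
Lemma bracketE eta mu f : bracket eta mu f = eta (mu f) - mu (eta f).
Proof. by []. Qed.
Lemma der_sumE (I : Type) (r : seq I) (P : pred I) (F : I -> Der iota) f :
  (\sum_(i <- r | P i) F i) f = \sum_(i <- r | P i) F i f.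
Proof. by elim/big_rec2: _ => // i x y _ <-. Qed.

Lemma bracketZ f g eta mu : bracket (f *: eta) (g *: mu) =
  (f * (eta g : B)) *: mu - (g * (mu f : B)) *: eta + (f * g) *: bracket eta mu.
Proof.
apply: der_ext => h;
  rewrite !der_addE der_oppE !der_scaleE !bracketE !der_scaleE !derM.
ring.
Qed.

Definition der_stable (I : set B) := forall eta f, I f -> I (eta f).

Lemma der_ideal_pow (m : set B) eta n :
  ideal_pow m n.+1 `<=` [set f | ideal_pow m n (eta f)].
Proof.
have idm p := ideal_powP m p.
(* The added conjunct makes the set an ideal, since [eta (a * x)] has the term [eta a * x]. *)
suff h : ideal_pow m n.+1 `<=` [set f | ideal_pow m n f /\ ideal_pow m n (eta f)].
  by move=> f /h[].
elim: n => [|n IHn]; first by [].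
apply: ideal_powS_sub => [|a b ma mb].
  split=> [|x y [mx mex] [my mey]|a x [mx mex]].
  - by split; rewrite ?der0; exact: (ideal0 (idm _)).
  - by split; rewrite ?derD; apply: (idealD (idm _)).
  - split; first exact: (idealM (idm _)).
    by rewrite derM; apply: (idealD (idm _)); apply: (idealM (idm _)).
split; first exact: (idealM (idm _)).
rewrite derM; apply: (idealD (idm _)); first exact: (idealM (idm _)).
by apply: ideal_powMl => //; have [] := IHn _ mb.
Qed.

End DerivationTheory.

(** * Cotangent space at a closed point, Euler field and differential simplicity *)

Section Tangent.
Context {k : closedFieldType} {B : comNzRingType} {iota : {rmorphism k -> B}}.
Hypothesis char_k : [pchar k] =i pred0.
Hypotheses (fgB : fg_algebra iota) (smB : formally_smooth iota).

Section AtPoint.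
Context {chi : {rmorphism B -> k}} (chi_iota : forall c, chi (iota c) = c).
Local Notation m := (point_ideal chi).
Local Notation mpow := (ideal_pow m).
Let idm := point_idealP (chi := chi).
Let idmp n := ideal_powP m n.
Let in_m := point_ideal_sub chi_iota.

Definition lin_comb {n} (c : 'I_n -> k) (t : 'I_n -> B) : B :=
  \sum_i iota (c i) * t i.

Lemma lin_combD n (c d : 'I_n -> k) t :
  lin_comb (fun i => c i + d i) t = lin_comb c t + lin_comb d t.
Proof.
by rewrite /lin_comb -big_split; apply: eq_bigr => i _; rewrite rmorphD mulrDl.
Qed.

Lemma lin_combZ n e (c : 'I_n -> k) t :
  lin_comb (fun i => e * c i) t = iota e * lin_comb c t.
Proof.
by rewrite /lin_comb big_distrr; apply: eq_bigr => i _; rewrite rmorphM -mulrA.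
Qed.

Lemma lin_comb0 n (t : 'I_n -> B) : lin_comb (fun=> 0) t = 0.
Proof. by rewrite /lin_comb big1 // => i _; rewrite rmorph0 mul0r. Qed.

(** The [t i] represent a basis of [m / m^2]: algebra generators, shifted to vanish at the point,
    span this space, and a spanning family of least length is free. *)
Lemma cotangent_basis : exists d (t : 'I_d -> B),
  [/\ forall i, m (t i),
      forall a, m a -> exists c, mpow 2 (a - lin_comb c t)
    & forall c, mpow 2 (lin_comb c t) -> forall i, c i = 0].
Proof.
pose spans d (t : 'I_d -> B) := (forall i, m (t i)) /\
  forall a, m a -> exists c, mpow 2 (a - lin_comb c t).
have ex : exists d, `[< exists t, @spans d t >].
  have [s sB] := fgB; exists (size s); apply/asboolP.
  pose t (i : 'I_(size s)) := s`_i - iota (chi s`_i).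
  exists t; split=> [i|a ma]; first exact: in_m.
  suff [c hc] : exists c, mpow 2 (a - iota (chi a) - lin_comb c t).
    by exists c; have := hc; rewrite (_ : chi a = 0) // rmorph0 subr0.
  move: a {ma};
    apply: (sB [set a | exists c, mpow 2 (a - iota (chi a) - lin_comb c t)])
    => [c|x xs|x y [c hc] [d hd]|x y [c hc] [d hd]].
  - by exists (fun=> 0); rewrite chi_iota subrr lin_comb0 subrr;
    exact: (ideal0 (idmp 2)).
  - have ixs : (index x s < size s)%N by rewrite index_mem.
    exists (fun i => (i == Ordinal ixs)%:R);
      rewrite /lin_comb (bigD1 (Ordinal ixs)) //= big1.
      by rewrite eqxx rmorph1 mul1r addr0 /t nth_index // subrr;
        exact: (ideal0 (idmp 2)).
    by move=> i /negbTE->; rewrite rmorph0 mul0r.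
  - exists (fun i => c i + d i); rewrite lin_combD.
    have -> : x + y - iota (chi (x + y)) - (lin_comb c t + lin_comb d t) =
      (x - iota (chi x) - lin_comb c t) + (y - iota (chi y) - lin_comb d t).
      by rewrite !rmorphD /=; ring.
    exact: (idealD (idmp 2)).
  - exists (fun i => chi x * d i + chi y * c i); rewrite lin_combD !lin_combZ.
    have -> : x * y - iota (chi (x * y)) -
        (iota (chi x) * lin_comb d t + iota (chi y) * lin_comb c t) =
      iota (chi y) * (x - iota (chi x) - lin_comb c t) +
      iota (chi x) * (y - iota (chi y) - lin_comb d t) +
      (x - iota (chi x)) * (y - iota (chi y)) by rewrite !rmorphM /=; ring.
    apply: (idealD (idmp 2)).
      by apply: (idealD (idmp 2)); apply: (idealM (idmp 2)).
    by apply: ideal_powMl; [exact: in_m|apply: ideal_pow1; exact: in_m].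
case: (ex_minnP ex) => d /asboolP[t [tm tspan]] min.
exists d, t; split=> // c mc i0; apply/eqP/negPn/negP => ci0.
case: d t tm tspan c mc i0 ci0 min => [|d] t tm tspan c mc i0 ci0 min.
  by case: i0 {ci0}.
have := min d; rewrite ltnn => h; suff : false by []; apply: h; apply/asboolP.
exists (fun j => t (lift i0 j)); split=> [j|a ma]; first exact: tm.
have [e he] := tspan a ma.
exists (fun j => e (lift i0 j) + - (e i0 / c i0) * c (lift i0 j)).
rewrite (lin_combD (e \o lift i0)) (lin_combZ _ (c \o lift i0)).
suff -> : a - (lin_comb (e \o lift i0) (t \o lift i0) +
      iota (- (e i0 / c i0)) * lin_comb (c \o lift i0) (t \o lift i0)) =
    (a - lin_comb e t) + iota (e i0 / c i0) * lin_comb c t.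
  by apply: (idealD (idmp 2)) => //; exact: (idealM (idmp 2)).
rewrite /lin_comb [\sum_i iota (e i) * t i](bigD1_ord i0) //.
rewrite [\sum_i iota (c i) * t i](bigD1_ord i0) //=.
rewrite mulrDr mulrA -[iota _ * iota (c i0)]rmorphM divfK // rmorphN.
ring.
Qed.

(** Being unique, the coordinates of [a - iota (chi a)] in a basis of [m / m^2] are derivations at
    the point; smoothness lifts them to fields [eta i]. Then [\sum_i t i *: eta i] is the identity
    on [m / m^2]. *)
Lemma exists_euler_field : exists d (t : 'I_d -> B) (eta : 'I_d -> Der iota),
  (forall i, m (t i)) /\ forall a, m a -> mpow 2 (a - \sum_i t i * (eta i a : B)).
Proof.
have [d [t [tm tspan tfree]]] := cotangent_basis.
have /choice[c hc] a : exists c, mpow 2 (a - iota (chi a) - lin_comb c t).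
  exact/tspan/in_m.
have uniq_c a (e : 'I_d -> k) :
    mpow 2 (a - iota (chi a) - lin_comb e t) -> e =1 c a.
  move=> he i; apply/eqP; rewrite -subr_eq0 -mulN1r; apply/eqP.
  move: i; apply: tfree; rewrite lin_combD lin_combZ.
  have -> : lin_comb e t + iota (-1) * lin_comb (c a) t =
    (a - iota (chi a) - lin_comb (c a) t) - (a - iota (chi a) - lin_comb e t).
    by rewrite rmorphN rmorph1; ring.
  exact: (idealB (idmp 2)).
have /choice[eta etaE] (i : 'I_d) :
    exists eta : Der iota, forall b, chi (eta b) = c b i.
  apply: (lift_point_derivation smB chi_iota) => [x y|e|x y].
  - symmetry; apply: (uniq_c (x + y) (fun i => c x i + c y i));
    rewrite lin_combD.
    have -> : x + y - iota (chi (x + y)) - (lin_comb (c x) t + lin_comb (c y) t) =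
      (x - iota (chi x) - lin_comb (c x) t) + (y - iota (chi y) - lin_comb (c y) t).
      by rewrite !rmorphD /=; ring.
    exact: (idealD (idmp 2)).
  - symmetry; apply: (uniq_c (iota e) (fun=> 0)).
    by rewrite chi_iota lin_comb0 !subrr; exact: (ideal0 (idmp 2)).
  - symmetry; apply: (uniq_c (x * y) (fun i => chi x * c y i + chi y * c x i)).
    rewrite lin_combD !lin_combZ.
    have -> : x * y - iota (chi (x * y)) -
        (iota (chi x) * lin_comb (c y) t + iota (chi y) * lin_comb (c x) t) =
      iota (chi y) * (x - iota (chi x) - lin_comb (c x) t) +
      iota (chi x) * (y - iota (chi y) - lin_comb (c y) t) +
      (x - iota (chi x)) * (y - iota (chi y)) by rewrite !rmorphM /=; ring.
    apply: (idealD (idmp 2)).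
      by apply: (idealD (idmp 2)); apply: (idealM (idmp 2)).
    by apply: ideal_powMl; [exact: in_m|apply: ideal_pow1; exact: in_m].
exists d, t, eta; split=> // a ma.
have := hc a; rewrite (_ : chi a = 0) // rmorph0 subr0 => h.
have -> : \sum_i t i * (eta i a : B) =
    lin_comb (c a) t + \sum_i t i * ((eta i a : B) - iota (chi (eta i a))).
  rewrite /lin_comb -big_split; apply: eq_bigr => i _; rewrite -etaE /=; ring.
rewrite opprD addrA; apply: (idealB (idmp 2)) => //;
  apply: (ideal_sum (idmp 2)) => i _.
by apply: ideal_powMl => //; apply: ideal_pow1; exact: in_m.
Qed.

(** The Euler field acts on [m^n / m^(n+1)] as multiplication by [n], and sends the stable ideal [I]
    into [m^(n+1)] once [I] lies in [m^n]. Characteristic 0 allows division by [n]. *)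
Lemma der_stable_sub_pow (I : set B) : ideal I -> der_stable (iota := iota) I ->
  I `<=` m -> forall n, I `<=` mpow n.
Proof.
move=> idI stI Im n; elim: n => [//|n IHn] f If.
(* At [n = 0] the multiplier is not invertible; this case is the inclusion of [I] in [m]. *)
have [->|n_gt0] := posnP n; first by apply: ideal_pow1; exact: Im.
have [d [t [eta [tm euler]]]] := exists_euler_field.
pose E : Der iota := \sum_i t i *: eta i.
have EE a : E a = \sum_i t i * (eta i a : B) :> B.
  by rewrite /E der_sumE; apply: eq_bigr.
have Em a : m (E a).
  by rewrite EE; apply: (ideal_sum idm) => i _; exact: (idealMr idm).
have Epow p : mpow p `<=` [set x | mpow p x /\ mpow p.+1 ((E x : B) - x *+ p)].
  elim: p => [x _|p IHp].
    by split=> //; rewrite mulr0n subr0; apply: ideal_pow1; exact: Em.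
  apply: ideal_powS_sub => [|a b ma /IHp[mb mEb]].
    split=> [|x y [mx mEx] [my mEy]|a x [mx mEx]].
    - by split; rewrite ?der0 ?mul0rn ?subrr; exact: (ideal0 (idmp _)).
    - split; first exact: (idealD (idmp _)).
      rewrite derD mulrnDl opprD addrACA; exact: (idealD (idmp _)).
    - split; first exact: (idealM (idmp _)).
      have -> : (E (a * x) : B) - (a * x) *+ p.+1 =
          (E a : B) * x + a * ((E x : B) - x *+ p.+1) by rewrite derM; ring.
      apply: (idealD (idmp _)); last exact: (idealM (idmp _)).
      by apply: ideal_powMl => //; exact: Em.
  split; first exact: ideal_powMl.
  have -> : (E (a * b) : B) - (a * b) *+ p.+1 =
      - (a - (E a : B)) * b + a * ((E b : B) - b *+ p) by rewrite derM; ring.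
  apply: (idealD (idmp _)); last exact: ideal_powMl.
  have := ideal_powD (n := 2) (idealN (idmp 2) (euler a ma)) mb.
  by rewrite EE.
have nf : mpow n.+1 (f *+ n).
  have [_] := Epow n f (IHn f If).
  suff : mpow n.+1 (E f) by move=> h1 /(idealB (idmp _) h1);
    rewrite opprB addrC subrK.
  rewrite EE; apply: (ideal_sum (idmp _)) => i _; apply: ideal_powMl => //.
  by apply: IHn; exact: stI.
have n0 : (n%:R : k) != 0 by have /pcharf0P-> := char_k; rewrite -lt0n.
have := idealM (idmp n.+1) (iota n%:R^-1) nf.
by rewrite -(mulr_natl f) mulrA -(rmorph_nat iota) -rmorphM mulVf // rmorph1 mul1r.
Qed.

(** If all fields sent [t] into [m], the Euler congruence would put [t] in [m^2]. *)
Lemma notin_sqr_der t : m t -> ~ mpow 2 t -> exists eta : Der iota, chi (eta t) != 0.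
Proof.
move=> mt m2t; have [d [s [eta [sm euler]]]] := exists_euler_field.
apply: contrapT => /forallNP h; apply: m2t.
rewrite -[t](subrK (\sum_i s i * (eta i t : B))).
apply: (idealD (idmp 2)); first exact: euler.
apply: (ideal_sum (idmp 2)) => i _; apply: ideal_powMl => //.
by apply: ideal_pow1; apply/eqP/negPn/negP; exact: h.
Qed.

End AtPoint.

(** A proper ideal lies in a prime, hence in the maximal ideal of a closed point; a stable one is
    then in all powers of it, so it is 0 by Krull's theorem. *)
Lemma der_simple (I : set B) (f : B) : is_domain B -> ideal I ->
  der_stable (iota := iota) I -> I f -> f <> 0 -> I 1.
Proof.
move=> domB idI stI If f0; apply: contrapT => I1.
have [P prP IP] := exists_prime_ideal idI I1.
have P1 : ~ P 1 by case: prP.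
have [chi [chi_iota chiP _]] := fg_has_points fgB prP P1.
apply: f0; apply: (krull_intersection chi_iota domB fgB) => n.
by apply: (der_stable_sub_pow chi_iota idI stI) => // x /IP /chiP.
Qed.

End Tangent.

(** * Representations of the vector fields vanishing at a point *)

Lemma exists_left_kernel (k : fieldType) n p (A : 'M[k]_(n, p)) :
  (p < n)%N -> exists2 c : 'rV[k]_n, c != 0 & c *m A = 0.
Proof.
move=> pn; have : kermx A != 0.
  rewrite -mxrank_eq0 mxrank_ker -lt0n subn_gt0.
  exact: leq_ltn_trans (rank_leq_col A) pn.
by case/rowV0Pn => c /sub_kermxP cA c0; exists c.
Qed.

Lemma exists_lin_dep (k : fieldType) n p (v : 'I_n -> 'rV[k]_p) : (p < n)%N ->
  exists2 c : 'rV[k]_n, c != 0 & \sum_i c 0 i *: v i = 0.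
Proof.
move=> pn; have [c c0 cA] := @exists_left_kernel k n p (\matrix_i v i) pn.
by exists c => //; rewrite -[RHS]cA mulmx_sum_row; apply: eq_bigr => i _;
  rewrite rowK.
Qed.

Section Representation.
Context {k : closedFieldType} {B : comNzRingType} {iota : {rmorphism k -> B}}.
Hypothesis char_k : [pchar k] =i pred0.
Hypotheses (domB : is_domain B) (fgB : fg_algebra iota) (smB : formally_smooth iota).
Context {chi : {rmorphism B -> k}} (chi_iota : forall c, chi (iota c) = c).
Local Notation m := (point_ideal chi).
Local Notation mpow := (ideal_pow m).
Let idm := point_idealP (chi := chi).
Let idmp n := ideal_powP m n.

Implicit Types (eta mu xi X Y : Der iota) (f g h t u : B).

(** The map [R] below is linear over [k] on all fields, but is asked to respect brackets of these
    fields only. *)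
Definition vanishing (eta : Der iota) := forall f, m (eta f).

Context {r : nat} (R : Der iota -> 'M[k]_r).
Hypotheses (RD : forall eta mu, R (eta + mu) = R eta + R mu)
  (RZ : forall c eta, R (iota c *: eta) = c *: R eta)
  (RL : forall eta mu, vanishing eta -> vanishing mu ->
    R (bracket eta mu) = R eta *m R mu - R mu *m R eta).

Let nat_neq0 n : (0 < n)%N -> (n%:R : k) != 0.
Proof. by move=> n0; have /pcharf0P-> := char_k; rewrite -lt0n. Qed.

Let natr_inj (i j : nat) : (i%:R : k) = j%:R -> i = j.
Proof.
wlog le_ij : i j / (i <= j)%N => [hw|].
  by case/orP: (leq_total i j) => [/hw|/hw h /esym/h].
move/eqP; rewrite eq_sym -subr_eq0 -natrB // => /eqP h.
apply/eqP; rewrite eqn_leq le_ij leqNgt -subn_gt0; apply/negP => /nat_neq0.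
by rewrite h eqxx.
Qed.

Let R0 : R 0 = 0.
Proof. by apply: (addrI (R 0)); rewrite -RD !addr0. Qed.

Let RN eta : R (- eta) = - R eta.
Proof. by apply: (addrI (R eta)); rewrite -RD !subrr R0. Qed.

Let RB eta mu : R (eta - mu) = R eta - R mu.
Proof. by rewrite RD RN. Qed.

Let Rsum (I : Type) (s : seq I) (P : pred I) (F : I -> Der iota) :
  R (\sum_(i <- s | P i) F i) = \sum_(i <- s | P i) R (F i).
Proof. by elim/big_rec2: _ => [|i x y _ <-]; rewrite ?R0 ?RD. Qed.

Let domM (x y : B) : x <> 0 -> y <> 0 -> x * y <> 0.
Proof. by case: domB => _ dom x0 y0 /dom[]. Qed.

Let domX (x : B) n : x <> 0 -> x ^+ n <> 0.
Proof.
move=> x0; elim: n => [|n IHn]; first by rewrite expr0; case: domB.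
by rewrite exprS; exact: domM.
Qed.

Lemma vanishing_scale h eta : m h -> vanishing (h *: eta).
Proof. by move=> mh f; rewrite der_scaleE; exact: (idealMr idm). Qed.

Lemma rep_bracketZ f g eta mu : m f -> m g ->
  R ((f * (eta g : B)) *: mu) - R ((g * (mu f : B)) *: eta) +
    R ((f * g) *: bracket eta mu) =
  R (f *: eta) *m R (g *: mu) - R (g *: mu) *m R (f *: eta).
Proof.
by move=> mf mg; rewrite -RL ?bracketZ ?RD ?RN //; exact: vanishing_scale.
Qed.

Lemma rep_bracket_ker f g eta mu : m f -> m g -> R (f *: eta) = 0 ->
  R ((f * (eta g : B)) *: mu) - R ((g * (mu f : B)) *: eta) +
    R ((f * g) *: bracket eta mu) = 0.
Proof. by move=> mf mg Rf; rewrite rep_bracketZ // Rf mul0mx mulmx0 subrr. Qed.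

(** A nonzero [t] in [m] is transcendental over [k]: evaluation at the point kills the constant term
    of a relation, and the rest is divisible by [t]. *)
Lemma horner_point_eq0 (t : B) (q : {poly k}) : m t -> t <> 0 ->
  (map_poly iota q).[t] = 0 -> q = 0.
Proof.
move=> mt t0; elim/poly_ind: q => [//|q c IHq].
rewrite rmorphD rmorphM /= map_polyX map_polyC !hornerE => h.
have qt : (map_poly iota q).[t] * t + iota c = 0 := h.
have c0 : c = 0.
  have := congr1 chi qt;
    rewrite rmorphD rmorphM /= (_ : chi t = 0) // mulr0 add0r.
  by rewrite chi_iota rmorph0.
move: qt; rewrite c0 rmorph0 addr0 => qt;
  have [/IHq->|//] := (proj2 domB) _ _ qt.
by rewrite mul0r add0r.
Qed.

(** The [r^2 + 1] matrices [R (t^i xi)] are linearly dependent; the relation gives a [u], nonzero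
    because [t] is transcendental. *)
Lemma rep_exists_ker t xi : m t -> t <> 0 ->
  exists u, [/\ m u, u <> 0 & R (u *: xi) = 0].
Proof.
move=> mt t0.
have [c c0 cR] := @exists_lin_dep k (r * r).+1 (r * r)
  (fun i => mxvec (R (t ^+ i.+1 *: xi))) (ltnSn _).
exists (\sum_i iota (c 0 i) * t ^+ i.+1); split.
- by apply: (ideal_sum idm) => i _; apply: (idealM idm); exact: (idealX idm).
- move=> u0; apply: (negP c0); apply/eqP; suff : rVpoly c = 0.
    by move=> pc; rewrite -[c]rVpolyK pc linear0.
  apply: (horner_point_eq0 mt t0).
  have : t * (map_poly iota (rVpoly c)).[t] = 0.
    rewrite -[RHS]u0 (@horner_coef_wide _ (r * r).+1); last first.
      by rewrite size_map_poly; exact: size_poly.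
    rewrite big_distrr; apply: eq_bigr => i _.
    by rewrite coef_map coef_rVpoly_ord /= exprS; ring.
  by case: domB => _ dom /dom[].
- rewrite scaler_suml Rsum; apply: (can_inj mxvecK);
  rewrite linear0 linear_sum -[RHS]cR.
  by apply: eq_bigr => i _; rewrite -scalerA RZ linearZ.
Qed.

(* The Wronskian bracket [{h, c} = h * xi c - c * xi h] of the fields
   [h *: xi]: from [u] in the kernel one gets successively [u^2 h'],
   [u^3 a' c'] and [u^3 a' b' c], using only brackets. *)
Lemma rep_kernel_module u xi c a b : m u -> R (u *: xi) = 0 ->
  R ((u ^+ 3 * (xi a : B) * (xi b : B) * c) *: xi) = 0.
Proof.
move=> mu Ru.
have xixi : bracket xi xi = 0 by apply: der_ext => f; rewrite bracketE subrr.
pose N h := m h /\ R (h *: xi) = 0.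
have ND h h' : N h -> N h' -> N (h + h').
  by move=> [mh Rh] [mh' Rh']; split;
    [exact: (idealD idm)|rewrite scalerDl RD Rh Rh' addr0].
have NZ e h : N h -> N (iota e * h).
  by move=> [mh Rh]; split;
    [exact: (idealM idm)|rewrite -scalerA RZ Rh scaler0].
have half h : N (h *+ 2) -> N h.
  move=> /(NZ 2%:R^-1);
    rewrite -(mulr_natl h) mulrA -(rmorph_nat iota) -rmorphM.
  by rewrite mulVf ?rmorph1 ?mul1r //; exact: nat_neq0.
have NL h d : N h -> m d -> N (h * (xi d : B) - d * (xi h : B)).
  move=> [mh Rh] md; have := rep_bracket_ker (eta := xi) xi mh md Rh.
  rewrite xixi scaler0 R0 addr0 -RB -scalerBl => ?; split=> //.
  by apply: (idealB idm); exact: (idealMr idm).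
have N1 h : N (u ^+ 2 * (xi h : B)).
  have := NL u (u * h) (conj mu Ru) (idealMr idm _ mu).
  by rewrite derM; congr N; ring.
(* The bracket of [u^2 d'] and [u e], plus [u^2 (u d' e)'], equals [2 u^3 d' e']. *)
have N2 d e : N (u ^+ 3 * (xi d : B) * (xi e : B)).
  have := NL _ (u * e) (N1 d) (idealMr idm _ mu).
  move=> /ND/(_ (N1 (u * (xi d : B) * e))) h; apply: half; move: h.
  by rewrite !derM ?(derX _ _ 1); congr N; ring.
(* This rests on [a' (b c)' + b' (a c)' - c' (a b)' = 2 a' b' c]. *)
have := ND _ _ (ND _ _ (N2 a (b * c)) (N2 b (a * c))) (NZ (-1) _ (N2 c (a * b))).
rewrite !derM rmorphN rmorph1 => h;
  suff [] : N (u ^+ 3 * (xi a : B) * (xi b : B) * c) by [].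
by apply: half; move: h; congr N; ring.
Qed.

(** In the bracket of [q^2 d xi] with [h X], the term along [xi] is a multiple of [q], hence killed.
    Comparing [(d, h) = (c t, t)] with [(c, t^2)] eliminates [bracket xi X] and leaves
    [q^2 c t (xi t) X]. *)
Lemma rep_kernel_all t xi : m t -> t <> 0 -> (xi t : B) <> 0 ->
  exists2 q, q <> 0 & forall c X, R ((q * c) *: X) = 0.
Proof.
move=> mt t0 g0; have [u [mu u0 Ru]] := rep_exists_ker xi mt t0.
pose q := u ^+ 3 * (xi t : B) ^+ 2.
have mq : m q by apply: (idealMr idm); exact: (idealX idm).
have Rq c : R ((q * c) *: xi) = 0.
  by rewrite -(rep_kernel_module c t t mu Ru) /q; congr (R (_ *: _)); ring.
exists (q ^+ 2 * (xi t : B) * t).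
  by apply: (domM) => //; apply: (domM) => //; apply: domX; apply: domM;
    exact: domX.
move=> c X.
have F d h : m h -> R ((q ^+ 2 * d * (xi h : B)) *: X) +
    R ((q ^+ 2 * d * h) *: bracket xi X) = 0.
  move=> mh; have mqd : m (q ^+ 2 * d) by apply: (idealMr idm);
    exact: (idealX idm).
  have Rqd : R ((q ^+ 2 * d) *: xi) = 0 by rewrite expr2 -mulrA.
  rewrite -[RHS](rep_bracket_ker X mqd mh Rqd).
  suff -> : R ((h * (X (q ^+ 2 * d) : B)) *: xi) = 0 by rewrite subr0.
  rewrite -[RHS](Rq (h * ((X q : B) *+ 2 * d + q * (X d : B)))).
  by congr (R (_ *: _)); rewrite derM (derX _ _ 1); ring.
have := F (c * t) t mt; have := F c (t * t) (idealM idm _ mt).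
have -> : q ^+ 2 * c * (t * t) = q ^+ 2 * (c * t) * t by ring.
move=> F1 F2; have : R ((q ^+ 2 * c * (xi (t * t) : B)) *: X) =
    R ((q ^+ 2 * (c * t) * (xi t : B)) *: X).
  by apply: (addIr (R ((q ^+ 2 * (c * t) * t) *: bracket xi X))); rewrite F1 F2.
move/eqP; rewrite -subr_eq0 -RB -scalerBl => /eqP <-.
by congr (R (_ *: _)); rewrite derM; ring.
Qed.

Lemma rep_nilpotent : exists n, forall d X, mpow n d -> R (d *: X) = 0.
Proof.
have [m0|/existsNP[t /not_implyP[mt t0]]] := pselect (forall t, m t -> t = 0).
  exists 1%N => d X /(ideal_pow_sub idm)/m0->; by rewrite scale0r R0.
(* If every field killed [t], the ideal [t B] would be stable and contain 1, although [t] vanishes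
   at the point. *)
have [xi g0] : exists xi : Der iota, (xi t : B) <> 0.
  apply: contrapT => /forallNP h.
  have idI : ideal [set t * b | b in [set: B]].
    split=> [|_ _ [b _ <-] [c _ <-]|a _ [b _ <-]].
    - by exists 0 => //; rewrite mulr0.
    - by exists (b + c) => //; rewrite mulrDr.
    - by exists (a * b) => //; rewrite mulrCA.
  have [||b _ tb] := @der_simple _ _ _ char_k fgB smB
    [set t * b | b in [set: B]] t domB idI _ _ t0.
  - move=> eta _ [b _ <-]; exists (eta b) => //.
    have eta_t : (eta t : B) = 0 by apply: contrapT; exact: h.
    by rewrite derM eta_t mul0r add0r.
  - by exists 1 => //; rewrite mulr1.
  - by have /eqP := rmorph1 chi;
    rewrite -tb rmorphM (_ : chi t = 0) // mul0r eq_sym oner_eq0.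
have [q q0 Rq] := rep_kernel_all mt t0 g0.
(* The exponent [n.+1] makes the fields vanish at the point, so that brackets are available; [h]
   absorbs arbitrary functions. *)
pose I := [set c | exists n, forall d h X, mpow n.+1 d -> R ((d * c * h) *: X) = 0].
have [n In] : I 1; last first.
  by exists n.+1 => d X md; have := In d 1 X md; rewrite !mulr1.
apply: (der_simple char_k fgB smB domB _ _ _ q0).
- split=> [|x y [n nx] [p py]|a x [n nx]].
  + by exists 0%N => d h X _; rewrite mulr0 mul0r scale0r R0.
  + exists (maxn n p) => d h X md;
    rewrite mulrDr mulrDl scalerDl RD nx ?py ?addr0 //.
      by apply: ideal_pow_le md; rewrite ltnS leq_maxr.
    by apply: ideal_pow_le md; rewrite ltnS leq_maxl.
  + exists n => d h X md; have -> : d * (a * x) * h = d * x * (a * h) by ring.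
    exact: nx.
- move=> mu c [n nc]; exists n.+1 => d h X md; move: d md h X.
  apply: ideal_powS_sub => [|y d my md].
    split=> [h X|x y Rx Ry h X|a x Rx h X].
    + by rewrite !mul0r scale0r R0.
    + by rewrite !mulrDl scalerDl RD Rx Ry addr0.
    + by have -> : a * x * (mu c : B) * h = x * (mu c : B) * (a * h) by ring.
  move=> h X.
  have md1 : m (d * c * h) by do 2!apply: (idealMr idm);
    exact: (ideal_pow_sub idm md).
  (* Two of the three terms of this bracket are killed by the hypothesis on [c]; expanding
     [mu (d * c * h)] in the third one isolates [mu c]. *)
  have := rep_bracket_ker mu md1 my (nc _ _ X md).
  have -> : d * c * h * (X y : B) = d * c * (h * (X y : B)) by ring.
  have -> : d * c * h * y = d * c * (h * y) by ring.
  rewrite !nc // addr0 sub0r => /eqP; rewrite oppr_eq0 => /eqP <-.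
  have -> : y * (mu (d * c * h) : B) = y * d * (mu c : B) * h +
      d * c * (y * (mu h : B)) + y * (mu d : B) * c * h by rewrite !derM; ring.
  rewrite !scalerDl !RD nc // addr0 nc ?addr0 //.
  by apply: ideal_powMl => //; exact: der_ideal_pow md.
- by exists 0%N => d h X _; have -> : d * q * h = q * (d * h) by ring.
Qed.

(** Each entry of [f ((g + c h)^(p+1))] is a polynomial in [c] vanishing on the infinite field [k];
    its linear coefficient is [p + 1] times the entry of [f (h * g^p)]. *)
Lemma polarization_step (f : B -> 'M[k]_r) g h p :
  (forall x y, f (x + y) = f x + f y) -> (forall c x, f (iota c * x) = c *: f x) ->
  (forall c, f ((g + iota c * h) ^+ p.+1) = 0) -> f (h * g ^+ p) = 0.
Proof.
move=> fD fZ f0.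
have f00 : f 0 = 0 by apply: (addrI (f 0)); rewrite -fD !addr0.
have fMn x n : f (x *+ n) = f x *+ n.
  by elim: n => [|n IHn]; rewrite ?mulr0n // !mulrS fD IHn.
have fsum n (F : 'I_n -> B) : f (\sum_i F i) = \sum_i f (F i).
  by elim/big_rec2: _ => // i x y _ <-; rewrite fD.
apply/matrixP => i j; rewrite mxE.
pose P : {poly k} :=
  \poly_(l < p.+2) (f (g ^+ (p.+1 - l) * h ^+ l) i j *+ 'C(p.+1, l)).
have : P = 0.
  apply/eqP/negPn/negP => /closed_nonrootP[c /negP[]]; apply/rootP.
  rewrite horner_poly -[RHS](_ : f ((g + iota c * h) ^+ p.+1) i j = 0);
    last first.
    by rewrite f0 mxE.
  rewrite exprDn fsum summxE; apply: eq_bigr => l _.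
  rewrite exprMn -rmorphXn mulrCA fMn fZ mulmxnE !mxE.
  by rewrite mulrnAl mulrC.
move/(congr1 (fun q : {poly k} => q`_1)).
rewrite coef_poly /= coef0 subSS subn0 expr1 bin1 -mulr_natr => /eqP.
by rewrite mulf_eq0 (negbTE (nat_neq0 _)) // orbF mulrC => /eqP.
Qed.

Lemma rep_power_bound n t X : (r ^ 2 < n)%N ->
  (forall d Y, mpow n.+1 d -> R (d *: Y) = 0) -> m t -> R (t ^+ n *: X) = 0.
Proof.
move=> rn kill mt; apply: contrapT => RtX.
have n0 : (0 < n)%N by exact: leq_ltn_trans rn.
have m2t : ~ mpow 2 t.
  move=> m2t; apply: RtX; apply: kill; rewrite -(ltn_predK n0) exprS.
  exact: (ideal_powD (n := 2) m2t (ideal_powX _ mt)).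
have [xi0 xi0t] := notin_sqr_der fgB smB chi_iota mt m2t.
pose xi := iota (chi (xi0 t))^-1 *: xi0.
have xit : chi (xi t) = 1 by rewrite der_scaleE rmorphM chi_iota mulVf.
have Rchi s Y : R ((t ^+ n * s) *: Y) = chi s *: R (t ^+ n *: Y).
  apply/eqP; rewrite -subr_eq0 -RZ -RB scalerA -scalerBl [iota _ * _]mulrC -mulrBr.
  apply/eqP; apply: kill; rewrite mulrC; apply: ideal_powMl;
    last exact: ideal_powX.
  exact: point_ideal_sub.
(* Only terms of order exactly [n] in [t] survive, when the exponents add up to [n + 1]; by [Rchi]
   their coefficients matter only through their values at the point. *)
have comm a b Y : (n < a.+1 + b.+1)%N ->
    R (t ^+ a.+1 *: xi) *m R (t ^+ b.+1 *: Y) -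
    R (t ^+ b.+1 *: Y) *m R (t ^+ a.+1 *: xi) =
    if (a.+1 + b.+1 == n.+1)%N
    then b.+1%:R *: R (t ^+ n *: Y) -
      (a.+1%:R * chi (Y t)) *: R (t ^+ n *: xi)
    else 0.
  move=> nab; have mX l : m (t ^+ l.+1) by exact: (idealX idm).
  rewrite -rep_bracketZ //.
  have -> : R ((t ^+ a.+1 * t ^+ b.+1) *: bracket xi Y) = 0.
    apply: kill; rewrite -exprD;
      apply: (@ideal_pow_le _ _ _ (a.+1 + b.+1)) => //.
    exact: ideal_powX.
  rewrite addr0 !derX.
  have -> : t ^+ a.+1 * (t ^+ b * (xi t : B) *+ b.+1) =
     t ^+ (a + b).+1 * ((xi t : B) *+ b.+1) by rewrite -addSn exprD; ring.
  have -> : t ^+ b.+1 * (t ^+ a * (Y t : B) *+ a.+1) =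
     t ^+ (a + b).+1 * ((Y t : B) *+ a.+1) by rewrite addnC -addSn exprD; ring.
  case: eqP => [|/eqP] abn.
    have -> : (a + b).+1 = n by apply: succn_inj; rewrite -abn addSn addnS.
    by rewrite !Rchi !rmorphMn /= xit -(mulr_natl (chi (Y t))).
  have nab' : (n < (a + b).+1)%N by lia.
  have killX s Z : R ((t ^+ (a + b).+1 * s) *: Z) = 0.
    apply: kill; apply: (idealMr (idmp _)).
    by apply: (@ideal_pow_le _ _ _ (a + b).+1) => //; exact: ideal_powX.
  by rewrite !killX subr0.
(* [Y] is [X] if [R (t^n xi) = 0], and [xi] otherwise, so that the bracket is always a multiple of
   [R (t^n Y)]. The flag [e] marks the second case, where the multiplier vanishes for equal
   exponents. *)
have [Y [e [RY commY]]] : exists Y (e : bool), R (t ^+ n *: Y) <> 0 /\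
    forall a b, (n < a.+1 + b.+1)%N ->
    R (t ^+ a.+1 *: xi) *m R (t ^+ b.+1 *: Y) -
    R (t ^+ b.+1 *: Y) *m R (t ^+ a.+1 *: xi) =
    if (a.+1 + b.+1 == n.+1)%N
    then (b.+1%:R - (e * a.+1)%:R) *: R (t ^+ n *: Y) else 0.
  have [Rxi|Rxi] := pselect (R (t ^+ n *: xi) = 0).
    exists X, false; split=> // a b /comm->; case: ifP => // _.
    by rewrite Rxi scaler0 mul0n !subr0.
  exists xi, true; split=> // a b /comm->; case: ifP => // _.
  by rewrite xit mulr1 mul1n scalerBl.
pose v (i : 'I_n.+1) : 'M[k]_r := if val i is b.+1 then R (t ^+ b.+1 *: Y) else 1%:M.
(* An extra coordinate that forces the coefficient of index [(n + 1) / 2] to be 0, where the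
   multiplier may vanish. The [n + 1] vectors then lie in dimension [r^2 + 1], which is smaller. *)
pose mid (i : 'I_n.+1) : 'M[k]_1 := (val i == (n.+1)./2)%:R%:M.
have [c c0 cv] := @exists_lin_dep k n.+1 (r * r + 1)
  (fun i => row_mx (mxvec (v i)) (mid i)) ltac:(by rewrite addn1 ltnS mulnn).
have cR : \sum_i c 0 i *: v i = 0.
  apply: (can_inj mxvecK);
    rewrite linear0 linear_sum -[RHS](linear0 (@lsubmx k 1 (r * r) 1)).
  rewrite -cv linear_sum; apply: eq_bigr => i _.
  by rewrite !linearZ /= row_mxKl.
have cM : \sum_i c 0 i *: mid i = 0.
  rewrite -[RHS](linear0 (@rsubmx k 1 (r * r) 1)) -cv linear_sum;
    apply: eq_bigr => i _.
  by rewrite linearZ /= row_mxKr.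
have cmid (i : 'I_n.+1) : val i = (n.+1)./2 -> c 0 i = 0.
  move=> imid; have := congr1 (fun u : 'M_1 => u 0 0) cM.
  rewrite summxE mxE (bigD1 i) //= big1 => [|j ji].
    by rewrite !mxE imid eqxx mulr1n mulr1 addr0.
  by rewrite !mxE -imid (inj_eq val_inj) (negbTE ji) mulr1n mulr0.
have cS b (bn : (b.+1 < n.+1)%N) : c 0 (Ordinal bn) = 0.
  elim/ltn_ind: b bn => b IHb bn.
  have [bmid|bmid] := eqVneq (b.+1) (n.+1)./2; first exact: cmid.
  pose a := (n - b.+1)%N;
    have ab : (a.+1 + b.+1 = n.+1)%N by rewrite addSn subnK.
  (* Commuting with [R (t^(a+1) xi)] removes the identity, the lower indices by induction, and the
     higher ones because the exponents exceed [n + 1]. The index [b + 1] remains. *)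
  have := congr1 (fun A => R (t ^+ a.+1 *: xi) *m A - A *m R (t ^+ a.+1 *: xi)) cR.
  rewrite mulmx0 mul0mx subrr mulmx_sumr mulmx_suml -sumrB (bigD1 (Ordinal bn)) //=.
  rewrite big1 ?addr0 => [|[[|i] /= iP] ib].
  - rewrite -scalemxAr -scalemxAl -scalerBr commY ab ?eqxx //.
    move/eqP; rewrite !scaler_eq0 => /orP[/eqP//|/orP[|/eqP/RY//]].
    rewrite subr_eq0 => /eqP/natr_inj eab; exfalso.
    by move: eab bmid; case: (e); lia.
  - by rewrite /v /= -scalemxAr -scalemxAl mulmx1 mul1mx subrr.
  - have [ltib|] := ltnP i b.
      by rewrite IHb // scale0r mulmx0 mul0mx subrr.
    rewrite leq_eqVlt => /orP[/eqP bi|bi].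
      by move: ib; rewrite -val_eqE /= bi eqxx.
    rewrite -scalemxAr -scalemxAl -scalerBr commY.
      by rewrite ifF ?scaler0 // -ab eqn_add2l eqSS gtn_eqF.
    by lia.
have cS' i : i != ord0 -> c 0 i = 0.
  by case: i => -[|i] iP // _; exact: cS.
apply: (negP c0); apply/eqP/rowP => i; rewrite mxE.
have [->|/cS'//] := eqVneq i ord0.
move: cR; rewrite (bigD1 ord0) //= big1 => [|j /cS'->]; last by rewrite scale0r.
rewrite addr0 => /eqP; rewrite scaler_eq0 => /orP[/eqP//|/eqP v0].
by case: RY; rewrite -[R _]mulmx1 -[1%:M]/(v ord0) v0 mulmx0.
Qed.

(** Descending induction from the exponent of [rep_nilpotent]: if [m^(p+1)] is killed, so are [p]-th
    powers of elements of [m], hence all of [m^p] by polarization. *)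
Lemma rep_bound n d X : (r ^ 2 < n)%N -> mpow n d -> R (d *: X) = 0.
Proof.
move=> rn; have [N killN] := rep_nilpotent.
have [i Nin] : exists i, (N <= n + i)%N by exists N; exact: leq_addl.
have : forall d X, mpow (n + i)%N d -> R (d *: X) = 0.
  by move=> e Y me; apply: killN; exact: ideal_pow_le me.
elim: i d X {Nin} => [|i IHi] d X; first by rewrite addn0; exact.
rewrite addnS => kill; apply: IHi => {}d {}X.
have {}rn : (r ^ 2 < n + i)%N by exact: leq_trans (leq_addr _ _).
set p := (n + i)%N in rn kill *.
pose J := [set d | forall X, R (d *: X) = 0].
have idJ : ideal J.
  split=> [Y|x y Jx Jy Y|a x Jx Y]; first by rewrite scale0r R0.
    by rewrite scalerDl RD Jx Jy addr0.
  by rewrite mulrC -scalerA.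
(* Polarization replaces one factor [g] at a time by an arbitrary element of [m]; at [j = p] the
   remaining power is [g ^+ 0 = 1]. *)
have Jpow j e g : (j <= p)%N -> mpow j e -> m g -> J (e * g ^+ (p - j)).
  elim: j e g => [|j IHj] e g jp.
    by move=> _ mg; apply: (idealM idJ) => Y; rewrite subn0;
      exact: rep_power_bound.
  move=> me mg; move: e me; apply: ideal_powS_sub => [|h e mh me].
    split=> [|x y Jx Jy|a x Jx] /=; first by rewrite mul0r; exact: (ideal0 idJ).
      by rewrite mulrDl; exact: (idealD idJ).
    by rewrite -mulrA; exact: (idealM idJ).
  move=> Y; have -> : h * e * g ^+ (p - j.+1) = h * g ^+ (p - j.+1) * e by ring.
  rewrite -scalerA.
  apply: (@polarization_step (fun x => R (x *: (e *: Y))) g h) => [x y|c x|c].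
  - by rewrite scalerDl RD.
  - by rewrite -scalerA RZ.
  - rewrite scalerA mulrC -subSn // subSS; apply: IHj => //; first exact: ltnW.
    by apply: (idealD idm) => //; exact: (idealM idm).
by move=> md; have := Jpow p d 0 (leqnn p) md (ideal0 idm);
  rewrite subnn mulr1; exact.
Qed.

End Representation.

(** * Modules with a compatible action of the derivations *)

Section InfinitesimallyEquivariantModule.
Context {k : closedFieldType} {B : comNzRingType} {iota : {rmorphism k -> B}}.
Hypothesis char_k : [pchar k] =i pred0.
Hypotheses (domB : is_domain B) (fgB : fg_algebra iota) (smB : formally_smooth iota).
Context (M : lmodType B) (L : Der iota -> At iota M).
Implicit Types x y z : M.
Hypotheses (L_klinear : klinear iota L)
  (L_bracket : forall eta mu x,
    L (bracket eta mu) x = L eta (L mu x) - L mu (L eta x))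
  (L_leibniz : forall eta f x, L eta (f *: x) = (eta f : B) *: x + f *: L eta x).
Context {n : nat} (g : 'I_n -> M).
Hypothesis g_gen : forall x, exists f : 'I_n -> B, x = \sum_i f i *: g i.
Context {r : nat} (s : 'I_r -> M).
Hypotheses (s_free : forall f : 'I_r -> B, \sum_i f i *: s i = 0 -> forall i, f i = 0)
  (s_span : forall x, exists (d : B) (f : 'I_r -> B),
    d <> 0 /\ d *: x = \sum_i f i *: s i).

Let domM (x y : B) : x <> 0 -> y <> 0 -> x * y <> 0.
Proof. by case: domB => _ dom x0 y0 /dom[]. Qed.

Let LD eta x y : L eta (x + y) = L eta x + L eta y.
Proof. by have /is_atiyahP[[]] := at_funP (L eta). Qed.

Let L0 eta : L eta 0 = 0.
Proof. by apply: (addrI (L eta 0)); rewrite -LD !addr0. Qed.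

Let Lsum eta (I : Type) (l : seq I) (P : pred I) (F : I -> M) :
  L eta (\sum_(i <- l | P i) F i) = \sum_(i <- l | P i) L eta (F i).
Proof. by elim/big_rec2: _ => [|i x y _ <-]; rewrite ?L0 ?LD. Qed.

Lemma common_denominator : exists d : B, d <> 0 /\
  forall x, exists f : 'I_r -> B, d *: x = \sum_i f i *: s i.
Proof.
pose span x := exists f : 'I_r -> B, x = \sum_i f i *: s i.
have spanD x y : span x -> span y -> span (x + y).
  move=> [e ->] [f ->]; exists (fun i => e i + f i).
  by rewrite -big_split; apply: eq_bigr => i _; rewrite scalerDl.
have spanZ c x : span x -> span (c *: x).
  move=> [f ->]; exists (fun i => c * f i).
  by rewrite scaler_sumr; apply: eq_bigr => i _; rewrite scalerA.
have span0 : span 0 by exists (fun=> 0); rewrite big1 // => i _;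
  rewrite scale0r.
have [d [d0 dg]] : exists d : B, d <> 0 /\ forall x, x \in codom g -> span (d *: x).
  elim: (codom g) => [|y l [d [d0 dl]]]; first by exists 1; split=> //;
    case: domB.
  have [e [f [e0 ey]]] := s_span y.
  exists (e * d); split=> [|x]; first exact: domM.
  rewrite inE => /orP[/eqP->|/dl]; last by rewrite -scalerA; exact: spanZ.
  by rewrite mulrC -scalerA; apply: spanZ; exists f.
exists d; split=> // x; have [f ->] := g_gen x.
rewrite scaler_sumr; apply: (big_ind span) => // i _.
by rewrite scalerA mulrC -scalerA; apply: spanZ; apply: dg; exact: codom_f.
Qed.

(** The annihilator of the torsion is stable, because [(eta c) y = eta (c y) - c (eta y)] and the
    action preserves torsion. It contains the common denominator [d], so it contains 1 by
    [der_simple]. *)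
Lemma infeq_torsion_free (e : B) x : e <> 0 -> e *: x = 0 -> x = 0.
Proof.
have [d [d0 dspan]] := common_denominator.
pose torsion y := exists2 c : B, c <> 0 & c *: y = 0.
pose I := [set c : B | forall y, torsion y -> c *: y = 0].
suff I1 : I 1 by move=> e0 ex; rewrite -[x]scale1r; apply: I1; exists e.
(* If [c] kills [y], then [c^2] kills [L eta y]. *)
have tor_act eta y : torsion y -> torsion (L eta y).
  move=> [c c0 cy]; exists (c * c); first exact: domM.
  have := congr1 (fun z => c *: L eta z) cy.
  have swap : c *: ((eta c : B) *: y) = (eta c : B) *: (c *: y).
    by rewrite !scalerA mulrC.
  by rewrite L_leibniz L0 scalerDr swap cy !scaler0 add0r scalerA.
apply: (der_simple char_k fgB smB domB _ _ _ d0) => [|eta c Ic y ty|y [c c0 cy]].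
- split=> [y _|a b Ia Ib y ty|a b Ib y ty]; first exact: scale0r.
    by rewrite scalerDl Ia // Ib // addr0.
  by rewrite -scalerA Ib // scaler0.
- have := L_leibniz eta c y; rewrite Ic // L0 Ic ?addr0 => [<- //|].
  exact: tor_act.
- have [f df] := dspan y; rewrite df big1 // => i _.
  have : \sum_i (c * f i) *: s i = 0.
    under eq_bigr do rewrite -scalerA.
    by rewrite -scaler_sumr -df scalerA mulrC -scalerA cy scaler0.
  by move=> /s_free/(_ i); case: domB => _ dom /dom[//|->]; rewrite scale0r.
Qed.

Lemma commutator_klinear {U V : lmodType B} (phi : U -> V) (f : B) :
  klinear iota phi -> klinear iota (commutator phi f).
Proof.
move=> [phiD phiZ]; split=> [x y|c x]; rewrite /commutator.
  by rewrite scalerDr !phiD scalerDr opprD addrACA.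
by rewrite scalerA mulrC -scalerA !phiZ scalerA mulrC -scalerA -scalerBr.
Qed.

(** * The fibre of the module at a closed point *)

Section Fibre.
Context (chi : {rmorphism B -> k}) (chi_iota : forall c, chi (iota c) = c).
Local Notation m := (point_ideal chi).
Context (d : B) (coef : M -> 'I_r -> B) (chi_d : chi d != 0).
Hypothesis coefE : forall x, d *: x = \sum_i coef x i *: s i.

(** The value of [x] at the point in the frame [s]; since [coef x] describes [d *: x], it is divided
    by [chi d]. *)
Definition fibre_eval (x : M) : 'cV[k]_r := \col_i (chi (coef x i) / chi d).

Lemma coef_unique x f : d *: x = \sum_i f i *: s i -> forall i, coef x i = f i.
Proof.
move=> df i; apply/eqP; rewrite -subr_eq0; apply/eqP; move: i.
apply: (s_free (f := fun i => coef x i - f i)).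
by under eq_bigr do rewrite scalerBl; rewrite sumrB -coefE df subrr.
Qed.

Lemma fibre_evalD x y : fibre_eval (x + y) = fibre_eval x + fibre_eval y.
Proof.
apply/colP => i; rewrite !mxE (@coef_unique _ (fun i => coef x i + coef y i)).
  by rewrite rmorphD mulrDl.
rewrite scalerDr !coefE -big_split; apply: eq_bigr => j _;
  exact: esym (scalerDl _ _ _).
Qed.

Lemma fibre_evalZ c x : fibre_eval (c *: x) = chi c *: fibre_eval x.
Proof.
apply/colP => i; rewrite !mxE (@coef_unique _ (fun i => c * coef x i)).
  by rewrite rmorphM mulrA.
rewrite scalerA mulrC -scalerA coefE scaler_sumr; apply: eq_bigr => j _.
exact: scalerA.
Qed.

Lemma fibre_eval_basis j : fibre_eval (s j) = delta_mx j 0.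
Proof.
apply/colP => i; rewrite !mxE (@coef_unique _ (fun i => (i == j)%:R * d)).
  by rewrite andbT rmorphM /= mulfK // rmorph_nat.
by rewrite (bigD1 j) //= eqxx mul1r big1 ?addr0 // => l /negbTE->;
  rewrite mul0r scale0r.
Qed.

Lemma fibre_eval0 : fibre_eval 0 = 0.
Proof. by rewrite -(scale0r 0) fibre_evalZ rmorph0 scale0r. Qed.

Lemma fibre_evalB x y : fibre_eval (x - y) = fibre_eval x - fibre_eval y.
Proof. by rewrite -scaleN1r fibre_evalD fibre_evalZ rmorphN rmorph1 scaleN1r. Qed.

Lemma fibre_eval_sum (I : Type) (l : seq I) (P : pred I) (F : I -> M) :
  fibre_eval (\sum_(i <- l | P i) F i) = \sum_(i <- l | P i) fibre_eval (F i).
Proof.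
by elim/big_rec2: _ => [|i x y _ <-]; rewrite ?fibre_eval0 ?fibre_evalD.
Qed.

Definition fibre_rep (eta : Der iota) : 'M[k]_r :=
  \matrix_(i, j) fibre_eval (L eta (s j)) i 0.

Lemma col_fibre_rep eta j : col j (fibre_rep eta) = fibre_eval (L eta (s j)).
Proof. by apply/colP => i; rewrite !mxE. Qed.

(** The Leibniz term [eta f] vanishes at the point, so [L eta] descends to a linear map of the
    fibre, determined by the frame. *)
Lemma fibre_repE eta x : vanishing (chi := chi) eta ->
  fibre_eval (L eta x) = fibre_rep eta *m fibre_eval x.
Proof.
move=> van; have van0 f : chi (eta f) = 0 by exact: van.
apply: (scalerI chi_d); rewrite scalemxAr.
have := congr1 (fun y => fibre_eval (L eta y)) (coefE x).
rewrite L_leibniz fibre_evalD !fibre_evalZ van0 scale0r add0r => ->.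
rewrite Lsum fibre_eval_sum; apply/colP => i; rewrite summxE [RHS]mxE.
apply: eq_bigr => j _;
  rewrite L_leibniz fibre_evalD !fibre_evalZ van0 scale0r add0r.
by rewrite !mxE [chi d * _]mulrC divfK // mulrC.
Qed.

Lemma fibre_rep_bracket eta mu :
  vanishing (chi := chi) eta -> vanishing (chi := chi) mu ->
  fibre_rep (bracket eta mu) =
    fibre_rep eta *m fibre_rep mu - fibre_rep mu *m fibre_rep eta.
Proof.
move=> ve vm; apply: trmx_inj; apply/row_matrixP => j; apply: trmx_inj.
rewrite -!tr_col !trmxK col_fibre_rep L_bracket fibre_evalB.
rewrite !fibre_repE // !fibre_eval_basis.
by rewrite colE mulmxBl !mulmxA.
Qed.

(** In the fibre [f] acts as the scalar [chi f], so a commutator with [f] amounts to multiplying the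
    field by [f - iota (chi f)]. *)
Lemma fibre_eval_commutators (phi : Der iota -> At iota M) (fs : seq B) eta x :
  klinear iota phi ->
  fibre_eval (foldl commutator phi fs eta x) =
  fibre_eval (phi ((\prod_(f <- fs) (f - iota (chi f))) *: eta) x).
Proof.
elim: fs phi eta => [|f fs IHfs] phi eta klin; first by rewrite big_nil scale1r.
rewrite /= IHfs ?big_cons; last exact: commutator_klinear.
set p := \prod_(_ <- _) _; rewrite -scalerA; set mu := p *: eta.
have [phiD phiZ] := klin.
have -> : commutator phi f mu x = phi (f *: mu) x - f *: phi mu x by [].
have -> : (f - iota (chi f)) *: mu = f *: mu + iota (- chi f) *: mu.
  by rewrite scalerBl rmorphN scaleNr.
rewrite phiD phiZ.
have -> : (phi (f *: mu) + iota (- chi f) *: phi mu) x =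
  phi (f *: mu) x + iota (- chi f) *: phi mu x by [].
by rewrite fibre_evalB fibre_evalD !fibre_evalZ chi_iota scaleNr.
Qed.

End Fibre.

Theorem infeq_module_diffop : diffop_le iota (r ^ 2) L.
Proof.
split=> // fs eta; apply: val_inj; apply/funext => x /=.
have [d [d0 /choice[coef coefE]]] := common_denominator.
apply: contrapT; set y := foldl commutator L fs eta x => y0.
have [i ci] : exists i, coef y i <> 0.
  apply/existsNP => c0; apply: y0; apply: (infeq_torsion_free d0).
  by rewrite coefE big1 // => i _; rewrite c0 scale0r.
have prime0 : prime_ideal [set x : B | x = 0].
  have [B1 dom] := domB; split=> //= [a b -> ->|a b ->]; first by rewrite addr0.
  by rewrite mulr0.
(* A closed point where neither the denominator nor the nonzero coordinate of [y] vanishes. *)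
have [chi [chi_iota _ chi0]] := fg_has_points fgB prime0 (domM d0 ci).
move: chi0; rewrite rmorphM mulf_eq0 negb_or => /andP[chi_d chi_c].
pose p := \prod_(f <- fs) (f - iota (chi f)).
(* Order at most [r^2] is tested on [r^2 + 1] functions, whence one factor more than the order. *)
have mp : ideal_pow (point_ideal chi) (r ^ 2).+1 p.
  rewrite -(size_tuple fs) /p; elim: (val fs) => [|f l IHl];
    first by rewrite big_nil.
  by rewrite big_cons; apply: ideal_powMl => //; exact: point_ideal_sub.
have rep0 : fibre_rep chi d coef (p *: eta) = 0.
  apply: (rep_bound char_k domB fgB smB chi_iota (R := fibre_rep chi d coef)
    _ _ _ eta (ltnSn (r ^ 2)) mp).
  - move=> e mu; apply/matrixP => i' j; rewrite [LHS]mxE.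
    have -> : L (e + mu) (s j) = L e (s j) + L mu (s j) by rewrite L_klinear.1.
    by rewrite (fibre_evalD chi coefE) !mxE.
  - move=> c e; apply/matrixP => i' j; rewrite [LHS]mxE.
    have -> : L (iota c *: e) (s j) = iota c *: L e (s j) by rewrite L_klinear.2.
    by rewrite (fibre_evalZ chi coefE) chi_iota !mxE.
  - exact: fibre_rep_bracket.
have := fibre_eval_commutators chi_iota coefE fs eta x L_klinear.
rewrite -/p fibre_repE //; last first.
  by apply: vanishing_scale;
    exact: (ideal_pow_sub (point_idealP (chi := chi)) mp).
move/(congr1 (fun v : 'cV_r => v i 0)); rewrite rep0 mul0mx !mxE => /eqP.
by rewrite mulf_eq0 invr_eq0 (negbTE chi_d) orbF (negbTE chi_c).
Qed.

End InfinitesimallyEquivariantModule.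

(* The coefficient rings of [{poly _}] must be nonzero in their type, whereas the
   rings of sections are only known to be nonzero by hypothesis. *)
Definition nonzero_ring {B : comPzRingType} (B1 : (1 : B) != 0) : Type := B.
HB.instance Definition _ (B : comPzRingType) (B1 : (1 : B) != 0) :=
  GRing.ComPzRing.on (nonzero_ring B1).
HB.instance Definition _ (B : comPzRingType) (B1 : (1 : B) != 0) :=
  GRing.PzSemiRing_isNonZero.Build (nonzero_ring B1) B1.

Lemma nonzero_ringE (B : comPzRingType) (B1 : (1 : B) != 0) :
  (nonzero_ring B1 : comPzRingType) = B.
Proof. by case: B B1 => T [? ? ? ? ? ? ? ? ? ? ?] B1. Qed.

Lemma infeq_module_diffop_pz (k : closedFieldType) (char_k : [pchar k] =i pred0)
    (B : comPzRingType) (iota : {rmorphism k -> B}) (domB : is_domain B)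
    (fgB : fg_algebra iota) (smB : formally_smooth iota)
    (M : lmodType B) (L : Der iota -> At iota M) (L_klinear : klinear iota L)
    (L_bracket : forall eta mu x,
      L (bracket eta mu) x = L eta (L mu x) - L mu (L eta x))
    (L_leibniz : forall eta f x,
      L eta (f *: x) = (eta f : B) *: x + f *: L eta x)
    (n : nat) (g : 'I_n -> M)
    (g_gen : forall x, exists f : 'I_n -> B, x = \sum_i f i *: g i)
    (r : nat) (s : 'I_r -> M)
    (s_free : forall f : 'I_r -> B, \sum_i f i *: s i = 0 -> forall i, f i = 0)
    (s_span : forall x, exists (d : B) (f : 'I_r -> B),
      d <> 0 /\ d *: x = \sum_i f i *: s i) :
  diffop_le iota (r ^ 2) L.
Proof.
have B1 : (1 : B) != 0 by apply/eqP; case: domB.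
(* With a variable [B'], the equality can be eliminated in all the data, whose types depend on
   [B]. *)
have [B' eB] : exists B' : comNzRingType, (B' : comPzRingType) = B.
  by exists (nonzero_ring B1); exact: nonzero_ringE.
clear B1.

case: _ / eB in iota domB fgB smB M L L_klinear L_bracket L_leibniz g g_gen
  s s_free s_span *.
exact: infeq_module_diffop s_free s_span.
Qed.

(** * Sections over affine opens of an integral scheme *)

Section Geometry.
Context {k : fieldType} {X : ringedSpace k}.

(** Uniqueness of gluing for the empty cover. *)
Lemma empty_sections_eq (U : openSet X) (f g : fn U) : (forall x, ~ pts U x) -> f = g.
Proof.
move=> U0.
have [t [_ tE]] := @fn_sheaf k X False U (False_rect _)
  (fun i => match i with end) (fun x Ux => False_ind _ (U0 x Ux))
  (fun i => match i with end) (fun i => match i with end).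
by rewrite -(tE f (fun i => match i with end)) (tE g (fun i => match i with end)).
Qed.

Lemma germ_unitM (U : openSet X) (f g : fn U) x :
  germ_unit f x -> germ_unit g x -> germ_unit (f * g) x.
Proof.
move=> [V [VU [Vx [f' ff']]]] [W [WU [Wx [g' gg']]]].
pose T := Defs.openI V W;
  have TU : pts T `<=` pts U := subset_trans (openI_subl V W) VU.
exists T, TU; split; first by split.
exists (fres (openI_subl V W) f' * fres (openI_subr V W) g').
rewrite rmorphM /= mulrACA -(fres_comp VU (openI_subl V W)).
rewrite -(fres_comp WU (openI_subr V W)).
by rewrite -!rmorphM ff' gg' !rmorph1 mulr1.
Qed.

Hypotheses (schX : scheme X) (redX : reduced X) (irrX : irreducible_space X).

(** If [basic_open f] is empty, 1 restricts to 0 there, so [f] is nilpotent and hence 0. *)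
Lemma affine_neq0_unit (U : affineOpen X) (f : fn U) :
  f <> 0 -> exists x, germ_unit f x.
Proof.
have [_ _ loc0 _] := affP U.
move=> f0; apply: contrapT => /forallNP fx; apply: f0.
have [n] := loc0 f 1 (empty_sections_eq (U := basic_open f) _ _ fx).
by rewrite mulr1; exact: redX.
Qed.

(** By irreducibility two nonempty basic opens meet; at a common point [f * g] is a unit of a
    nonzero stalk. *)
Lemma affine_domain (U : affineOpen X) : (1 : fn U) <> 0 -> is_domain (fn U).
Proof.
move=> U1; split=> // f g fg; apply: contrapT => /not_orP[f0 g0].
have [x fx] := affine_neq0_unit f0; have [y gy] := affine_neq0_unit g0.
have [z [fz gz]] : exists z, germ_unit f z /\ germ_unit g z.
  apply: contrapT => /forallNP fgN.
  have [_ /(_ (~` germ_unit f) (~` germ_unit g))[|||fT|gT]] := irrX.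
  - by apply: open_closedC; exact: openP (basic_open f).
  - by apply: open_closedC; exact: openP (basic_open g).
  - by rewrite -setCI -subTset => z _ /=; exact: fgN.
  - by have : [set: X] x by []; rewrite -fT; exact.
  - by have : [set: X] y by []; rewrite -gT; exact.
have Uz : pts U z by exact: (basic_open_sub f z fz).
by have [] := schX.1 U z Uz; rewrite -fg => /(_ (germ_unitM fz gz)).
Qed.

Context (xi : X) (gen_xi : generic_point xi).

Lemma generic_mem (V : set X) x : open V -> V x -> V xi.
Proof.
move=> oV Vx; have : closure [set xi] x by rewrite gen_xi.
by move=> /(_ V (open_nbhs_nbhs (conj oV Vx)))[y [-> ]].
Qed.

Lemma generic_unit_neq0 (U : openSet X) (f : fn U) : germ_unit f xi -> f <> 0.
Proof.
move=> fxi f0; have Uxi : pts U xi by exact: (basic_open_sub f xi fxi).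
by have [] := schX.1 U xi Uxi; rewrite -f0.
Qed.

Lemma fres_generic_inj (U : affineOpen X) (W : openSet X) (WU : W `<=` U) (g : fn U) :
  (1 : fn U) <> 0 -> pts W xi -> fres WU g = 0 -> g = 0.
Proof.
move=> U1 Wxi gW; have [_ basis loc0 _] := affP U.
have [_ dom] := affine_domain U1.
have [f [fxi fW]] := basis W WU xi Wxi.
have [n] : exists n, f ^+ n * g = 0.
  by apply: loc0; rewrite -(fres_comp WU fW) gW rmorph0.
have f0 := generic_unit_neq0 fxi.
elim: n => [|n IHn]; first by rewrite mul1r.
by rewrite exprS -mulrA => /dom[].
Qed.

Context (F : moduleSheaf X) (qcF : quasi_coherent F).

(** Multiplying by powers of [h], with [basic_open h] a neighbourhood of [xi], extends the basis of
    the stalk to sections over [U]. *)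
Lemma generic_frame (U : affineOpen X) (r : nat) : (1 : fn U) <> 0 ->
  stalk_rank F xi r -> exists s : 'I_r -> F U,
  (forall f : 'I_r -> fn U, \sum_i f i *: s i = 0 -> forall i, f i = 0) /\
  (forall m, exists (d : fn U) (f : 'I_r -> fn U),
     d <> 0 /\ d *: m = \sum_i f i *: s i).
Proof.
move=> U1 [U0 [s0 [U0xi [free0 span0]]]].
have [_ basis _ loc] := affP U; have domU := affine_domain U1;
  have [_ dom] := domU.
have Uxi : pts U xi by have [x x1] := affine_neq0_unit U1;
  exact: generic_mem (openP U) (basic_open_sub _ _ x1).
have expn0 (f : fn U) n : f <> 0 -> f ^+ n <> 0.
  move=> f0; elim: n => [|n IHn]; first by rewrite expr0.
  by rewrite exprS => /dom[].
have [h [hxi hU0]] := basis (Defs.openI U0 U) (openI_subr _ _) xi (conj U0xi Uxi).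
have h0 := generic_unit_neq0 hxi.
have {}hU0 : basic_open h `<=` U0 by apply: subset_trans hU0 _;
  exact: openI_subl.
pose Dh := basic_open h; pose DhU : Dh `<=` U := basic_open_sub h.
have /choice[p /choice[s sE]] i : exists n (m : F U),
    mres F DhU m = fres DhU h ^+ n *: mres F hU0 (s0 i).
  by have [_] := qcF h; exact.
exists s; split=> [f fs i|m].
  have [|W [WD [Wxi fW]]] :=
      free0 Dh hU0 (fun i => fres DhU (f i) * fres DhU h ^+ p i) hxi _ i.
    have := congr1 (mres F DhU) fs; rewrite raddf0 raddf_sum => fs0.
    rewrite -[RHS]fs0; apply: eq_bigr => j _.
    by rewrite mresZ sE scalerA.
  have : f i * h ^+ p i = 0.
    have WU : W `<=` U := subset_trans WD DhU.
    apply: (fres_generic_inj (WU := WU) U1 Wxi).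
    by rewrite -(fres_comp DhU WD) rmorphM rmorphXn.
  by move=> /dom[//|/(expn0 _ _ h0)].
have [W [WU0 [WU [f [Wxi mW]]]]] := span0 U m Uxi.
have [e [exi eW]] := basis (Defs.openI W Dh)
  (subset_trans (openI_subl W Dh) WU) xi (conj Wxi hxi).
have e0 := generic_unit_neq0 exi.
pose De := basic_open e; pose DeU : De `<=` U := basic_open_sub e.
have DeW : De `<=` W by apply: subset_trans eW _; exact: openI_subl.
have DeDh : De `<=` Dh by apply: subset_trans eW _; exact: openI_subr.
have DeU0 : De `<=` U0 := subset_trans DeW WU0.
have /choice[q /choice[g gE]] i : exists n (g : fn U),
    fres DeU g = fres DeU e ^+ n * fres DeW (f i) by exact: loc.
pose c i := \prod_(j | j != i) (h ^+ p j * e ^+ q j).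
pose d := \prod_j (h ^+ p j * e ^+ q j).
have d0 : d <> 0.
  rewrite /d; apply: (big_ind (fun x => x <> 0)) => [//|x y x0 y0 /dom[]//|j _].
  by move=> /dom[]; exact: expn0.
have sDe i : mres F DeU (s i) = fres DeU h ^+ p i *: mres F DeU0 (s0 i).
  rewrite -(mres_comp DhU DeDh) sE mresZ rmorphXn /= (fres_comp DhU DeDh DeU).
  by rewrite (mres_comp hU0 DeDh DeU0).
(* On [basic_open e] the difference is 0: [g i] and [s i] carry the factors [e^(q i)] and [h^(p i)],
   and [c i] the other factors of [d]. So a power of [e] kills it on [U]. *)
have [n hn] : exists n, e ^+ n *: (d *: m - \sum_i (c i * g i) *: s i) = 0.
  have [zero _] := qcF e; apply: zero; rewrite raddfB raddf_sum mresZ.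
  rewrite -(mres_comp WU DeW) mW raddf_sum scaler_sumr -sumrB big1 // => i _.
  rewrite !mresZ sDe (mres_comp WU0 DeW DeU0) !scalerA rmorphM gE.
  rewrite /d (bigD1 i) //= -/(c i) !rmorphM !rmorphXn /=.
  by rewrite -scalerBl [X in X *: _](_ : _ = 0) ?scale0r //; ring.
exists (e ^+ n * d), (fun i => e ^+ n * (c i * g i)); split.
  by move=> /dom[]; [exact: expn0|].
move: hn; rewrite scalerBr scalerA scaler_sumr => /eqP;
  rewrite subr_eq0 => /eqP->.
by apply: eq_bigr => i _; rewrite scalerA.
Qed.

End Geometry.

Theorem theorem5p3 (k : closedFieldType) (char_k : [pchar k] =i pred0)
    (X : ringedSpace k) (varX : variety X) (irrX : irreducible_space X)
    (smX : smooth X)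
    (F : moduleSheaf X) (qcF : quasi_coherent F) (ftF : finite_type F)
    (a : infeq F)
    (xi : X) (gen_xi : generic_point xi) (r : nat) (rankF : stalk_rank F xi r) :
  sheaf_diffop_le (r ^ 2)%N (@lie_map k X F a).
Proof.
move=> U; have [schX redX _ _] := varX; have [fgU smU] := smX U.
have klin : klinear (fcst U) (lie_map a (U := U)).
  split=> [eta mu|c eta]; apply: val_inj; apply/funext => m /=;
    first exact: actDl.
  exact: actZl.
(* Over the zero ring all modules are 0; otherwise [fn U] is a domain. *)
have [U1|U1] := pselect ((1 : fn U) = 0).
  split=> // fs eta; apply: val_inj; apply/funext => m.
  by rewrite -[LHS]scale1r -[RHS]scale1r U1 !scale0r.
have [n [g g_gen]] := ftF U.
have [s [s_free s_span]] := generic_frame schX redX irrX gen_xi qcF U1 rankF.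
apply: (infeq_module_diffop_pz char_k _ fgU smU klin _ _ g_gen s_free s_span).
- exact: affine_domain.
- by move=> eta mu m; exact: act_bracket.
- by move=> eta f m; exact: act_leibniz.
Qed.
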